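(* For every sufficiently large integer $n$ there exists a triangle-free $n$-vertex $d$-regular graph $G$ with $d \geq \frac{1}{20} n^{2/3}$ and $\lambda(G) \leq 200 (d \log n)^{1/2}$.
   Context: For a graph $G$ on $n$ vertices whose adjacency matrix has eigenvalues $\lambda_1 \geq \lambda_2 \geq \dots \geq \lambda_n$, write $\lambda(G) = \max\{|\lambda_2|, |\lambda_n|\}$. An $(n,d,\lambda)$-graph is a $d$-regular $n$-vertex graph $G$ with $\lambda(G)=\lambda$; the theorem asserts the existence of a triangle-free $(n,d,\lambda)$-graph with the stated bounds on $d$ and $\lambda$. Here $\log$ denotes the natural logarithm. *)

(* Defs.v *)
From mathcomp Require Import all_boot all_order all_algebra.
From mathcomp Require Import complex.
From mathcomp Require Import classical_sets reals exp.

Set Implicit Arguments.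
Unset Strict Implicit.
Unset Printing Implicit Defensive.

Import Order.TTheory GRing.Theory Num.Theory.

Local Open Scope ring_scope.

Record sgraph (n : nat) := SGraph {
  adj :> rel 'I_n;
  adj_sym : symmetric adj;
  adj_irr : irreflexive adj }.

Definition regular (n : nat) (G : sgraph n) (d : nat) : Prop :=
  forall x : 'I_n, #|[set y | G x y]| = d.

Definition triangle_free (n : nat) (G : sgraph n) : Prop :=
  forall x y z : 'I_n, ~~ [&& G x y, G y z & G x z].

Definition adjmx (R : realType) (n : nat) (G : sgraph n) : 'M[R]_n :=
  \matrix_(i, j) (G i j)%:R.

(* [s] lists the eigenvalues of [A], with multiplicity, in nonincreasing
   order. *)
Definition is_spectrum (R : realType) (n : nat) (A : 'M[R]_n) (s : seq R) :
    Prop :=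
  sorted >=%R s /\ char_poly A = \prod_(x <- s) ('X - x%:P).

(* The default value [::] is never taken when [A] is symmetric, by
   [eigenvaluesP] below. *)
Definition eigenvalues (R : realType) (n : nat) (A : 'M[R]_n) : seq R :=
  xget [::] [set s | is_spectrum A s].

(* [eigenvalues] is indexed from 0, so that lambda_2 and lambda_n have indices
   1 and n.-1. *)
Definition graph_lambda (R : realType) (n : nat) (G : sgraph n) : R :=
  let s := eigenvalues (adjmx R G) in Num.max `|s`_1| `|s`_n.-1|.

Lemma char_poly_conj (F : fieldType) (n : nat) (P D : 'M[F]_n) :
  P \in unitmx -> char_poly (invmx P *m D *m P) = char_poly D.
Proof.
move=> uP; rewrite /char_poly /char_poly_mx.
have uP' : map_mx polyC P \in unitmx.
  by rewrite unitmxE det_map_mx rmorph_unit // -unitmxE.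
have -> : 'X%:M - map_mx polyC (invmx P *m D *m P)
  = invmx (map_mx polyC P) *m ('X%:M - map_mx polyC D) *m map_mx polyC P.
  rewrite mulmxBr mulmxBl !map_mxM /= map_invmx; congr (_ - _).
  by rewrite scalar_mxC -mulmxA mulVmx // mulmx1.
by rewrite !det_mulmx mulrC mulrA -det_mulmx mulmxV // det1 mul1r.
Qed.

Lemma is_spectrum_uniq (R : realType) (n : nat) (A : 'M[R]_n) (s t : seq R) :
  is_spectrum A s -> is_spectrum A t -> s = t.
Proof.
move=> [ss es] [st et]; apply: (sorted_eq ge_trans ge_anti ss st).
by apply: prod_XsubC_eq; rewrite -es.
Qed.

Lemma is_spectrum_sym (R : realType) (n : nat) (A : 'M[R]_n) :
  A^T = A -> exists s, is_spectrum A s.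
Proof.
move=> symA; pose toC := real_complex R; pose AC := map_mx toC A.
have hA : AC \is hermsymmx.
  apply: realsym_hermsym.
    by apply/is_hermitianmxP; rewrite expr0 scale1r map_mx_id // /AC map_trmx symA.
  apply/mxOverP => i j; rewrite mxE.
  by rewrite realE /toC !lecR -realE num_real.
have rD := hermitian_spectral_diag_real hA.
have /orthomx_spectralP eA := hermitian_normalmx hA.
pose t := [seq complex.Re (spectral_diag AC 0 i) | i <- enum 'I_n].
exists (sort >=%R t); split.
  by apply: sort_sorted => x y; rewrite le_total.
rewrite (perm_big t) ?perm_sort //= big_map big_enum /=.
apply: (map_poly_inj toC); rewrite map_char_poly -/AC [in LHS]eA.
rewrite char_poly_conj ?spectral_unit // char_poly_trig ?diag_mx_is_trig //.
rewrite rmorph_prod /=; apply: eq_bigr => i _.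
rewrite rmorphB /= map_polyX map_polyC /= !mxE eqxx mulr1n.
by rewrite /toC RRe_real //; exact: (mxOverP rD).
Qed.

Lemma eigenvaluesP (R : realType) (n : nat) (A : 'M[R]_n) :
  A^T = A -> is_spectrum A (eigenvalues A).
Proof.
move=> /is_spectrum_sym [s As].
exact: (@xgetPex _ [::] [set s | is_spectrum A s]) (ex_intro _ s As).
Qed.

Lemma trmx_adjmx (R : realType) (n : nat) (G : sgraph n) :
  (adjmx R G)^T = adjmx R G.
Proof. by apply/matrixP => i j; rewrite !mxE adj_sym. Qed.

Lemma size_eigenvalues (R : realType) (n : nat) (G : sgraph n) :
  size (eigenvalues (adjmx R G)) = n.
Proof.
have [_ e] := eigenvaluesP (trmx_adjmx R G).
by have := size_char_poly (adjmx R G); rewrite e size_prod_XsubC => -[].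
Qed.

(* Main.v *)
Require Import Defs.
From mathcomp Require Import all_boot all_order all_algebra all_field.
From mathcomp Require Import reals sequences exp.
From mathcomp Require Import zify ring lra.

(* Let F be the field with q = 2^k elements, T an additive coset of size q/8 on
   which some additive l0 : F -> F_2 equals 1, and S the set of all
   t (y, y^2, y^3) with t in T and y nonzero. The Cayley graph of F^3 on S is
   triangle-free, because three columns (y, y^2, y^3) with distinct y are
   independent and T + T misses T; its nontrivial eigenvalues are at most 3q in
   absolute value, because the cubics that occur take each value at most 3 times
   and T has small Fourier l^1 norm.

   To reach every n, write n = c q^2 + c' q + r and keep c planes x_1 = a together
   with c' of the lines (a, *, z) of one more plane. All degrees are then within
   q/8 of each other and constant along lines. Two points of a line (a, *, z) have
   no common neighbour in the Cayley graph, since (0, 1, 0) is the nucleus of the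
   conic; so any triangle-free graph may be added inside each line, and suitable
   Cayley graphs of F equalise the degrees. The last r vertices are inserted by
   subdivision: one generator h is present in all lines, and the j-th new vertex
   is joined to an independent set I_j invariant under translation by h, from
   which the h-edges are removed. These modifications move the spectrum by O(q),
   which is O(sqrt d). *)

Set Implicit Arguments.
Unset Strict Implicit.
Unset Printing Implicit Defensive.

Import Order.TTheory GRing.Theory Num.Theory.
Local Open Scope ring_scope.

(** * Spectral bound for regular graphs *)

(** Matrix determinant lemma with the division cleared. The bordered matrix [M] is made block
    triangular from the right and from the left; the second multiplier contributes the factor
    [a]. *)
Lemma det_scalar_add_rank1 (R : comNzRingType) n (a : R) (u : 'cV[R]_n)
    (v : 'rV[R]_n) :
  a * \det (a%:M + u *m v) = a ^+ n * (a + (v *m u) 0 0).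
Proof.
pose M := block_mx a%:M (- u) v (1%:M : 'M_1).
have e1 : M *m block_mx 1%:M 0 (- v) 1%:M = block_mx (a%:M + u *m v) (- u) 0 1%:M.
  rewrite mulmx_block !mulmx1 !mulmx0 !add0r !mul1mx.
  by rewrite mulNmx mulmxN opprK subrr.
have e2 : block_mx 1%:M 0 (- v) a%:M *m M = block_mx a%:M (- u) 0 (a%:M + v *m u).
  rewrite mulmx_block !mul1mx !mul0mx !addr0 !mulmx1.
  by rewrite mulNmx mulmxN mulNmx opprK mul_mx_scalar mul_scalar_mx addNr addrC.
have d1 : \det M = \det (a%:M + u *m v).
  have := congr1 determinant e1.
  by rewrite det_mulmx det_lblock det_ublock !det1 !mulr1.
have := congr1 determinant e2.
rewrite det_mulmx det_lblock det_ublock det1 mul1r !det_scalar expr1 d1 => ->.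
by rewrite det_mx11 !mxE mulr1n.
Qed.

(* Subtracting [k] times the all-ones matrix only moves the eigenvalue [d] of the
   all-ones vector. *)
Lemma char_poly_deflate (F : fieldType) n (A : 'M[F]_n) (d k : F) :
  A *m const_mx 1 = d *: const_mx 1 :> 'cV_n ->
  ('X - d%:P) * char_poly (A - k *: const_mx 1)
    = ('X - (d - k *+ n)%:P) * char_poly A.
Proof.
move=> Ad; pose a : {poly F} := 'X - d%:P.
pose u : 'cV[{poly F}]_n := const_mx 1; pose v : 'rV[{poly F}]_n := const_mx k%:P.
have uv : u *m v = map_mx polyC (k *: const_mx 1).
  by apply/matrixP=> i j; rewrite !mxE big_ord1 !mxE mul1r mulr1.
have vu : (v *m u) 0 0 = (k *+ n)%:P.
  rewrite mxE (eq_bigr (fun=> k%:P)); last by move=> i _; rewrite !mxE mulr1.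
  by rewrite sumr_const card_ord polyCMn.
have Au : map_mx polyC A *m u = d%:P *: u.
  have -> : u = map_mx polyC (const_mx 1) by rewrite map_const_mx.
  by rewrite -map_mxM Ad map_mxZ.
(* [u] is an eigenvector of [char_poly_mx A] with eigenvalue [a], so [a] factors out of the rank-one
   update. *)
have e : char_poly_mx A *m (a%:M + u *m v)
    = a *: char_poly_mx (A - k *: const_mx 1).
  rewrite mulmxDr mul_mx_scalar /char_poly_mx mulmxA mulmxBl Au mul_scalar_mx.
  rewrite -scalerBl -scalemxAl uv -scalerDr map_mxB opprB.
  by congr (_ *: _); rewrite addrAC -addrA.
have := congr1 determinant e.
rewrite det_mulmx detZ => e'.
have an0 : a ^+ n != 0 by rewrite expf_neq0 // polyXsubC_eq0.
apply: (mulfI an0); rewrite -/a /char_poly.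
transitivity (a * (a ^+ n * \det (char_poly_mx (A - k *: const_mx 1)))).
  by rewrite mulrCA.
by rewrite -e' mulrCA det_scalar_add_rank1 vu /a polyCB; ring.
Qed.

Lemma eigenvalue_quad_bound (R : realType) n (B : 'M[R]_n) (L : R) :
  (forall x : 'rV[R]_n, `|(x *m B *m x^T) 0 0| <= L * \sum_i x 0 i ^+ 2) ->
  forall m, root (char_poly B) m -> `|m| <= L.
Proof.
move=> HB m; rewrite -eigenvalue_root_char => /eigenvalueP[x xB x0].
have e : (x *m B *m x^T) 0 0 = m * \sum_i x 0 i ^+ 2.
  rewrite xB -scalemxAl mxE mxE; congr (_ * _).
  by apply: eq_bigr => i _; rewrite mxE expr2.
have sp : 0 < \sum_i x 0 i ^+ 2.
  rewrite lt_def sumr_ge0 ?andbT => [|i _]; last exact: sqr_ge0.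
  apply: contraNneq x0 => s0; apply/eqP/rowP=> i; rewrite mxE.
  have /eqP := psumr_eq0P (fun i _ => sqr_ge0 (x 0 i)) s0 (i := i) isT.
  by rewrite sqrf_eq0 => /eqP.
have := HB x; rewrite e normrM (gtr0_norm sp).
by rewrite ler_pM2r.
Qed.

(** By deflation, the spectrum of [A] together with d - kn is that of [B] together with [d]. So at
    most one eigenvalue of [A], namely one copy of [d], escapes [-L, L]. The shift [k] is free and
    need not be d/n. *)
Lemma graph_lambda_le (R : realType) n (G : sgraph n) (d : nat) (k L : R) :
  (1 < n)%N -> regular G d -> 0 <= L ->
  (forall x : 'I_n -> R,
     `|\sum_i \sum_j (G i j)%:R * x i * x j - k * (\sum_i x i) ^+ 2|
       <= L * \sum_i x i ^+ 2) ->
  graph_lambda R G <= L.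
Proof.
move=> n1 reg L0 HQ; rewrite /graph_lambda.
have symA := trmx_adjmx R G; have sz := size_eigenvalues R G.
have [srt es] := eigenvaluesP symA.
set A := adjmx R G in symA srt es sz *; set s := eigenvalues A in srt es sz *.
pose B := A - k *: const_mx 1.
have symB : B^T = B by rewrite /B linearB linearZ /= symA trmx_const.
have [t [_ et]] := is_spectrum_sym symB.
have Ad : A *m const_mx 1 = d%:R *: const_mx 1 :> 'cV_n.
  apply/colP=> i; rewrite !mxE mulr1.
  rewrite (eq_bigr (fun j => (G i j)%:R)); last by move=> j _; rewrite !mxE mulr1.
  rewrite -natr_sum -(reg i) -sum1_card [in RHS]big_mkcond /=; congr (_%:R).
  by apply: eq_bigr => j _; rewrite inE; case: (G i j).
have := char_poly_deflate k Ad; rewrite -/B es et.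
rewrite -!(big_cons _ _ _ _ xpredT (fun x => 'X - x%:P)) => /prod_XsubC_eq pe.
have tL x : x \in t -> `|x| <= L.
  move=> xt; apply: (@eigenvalue_quad_bound _ _ B); last first.
    by rewrite et root_prod_XsubC.
  move=> y; suff -> : (y *m B *m y^T) 0 0 =
      \sum_i \sum_j (G i j)%:R * y 0 i * y 0 j - k * (\sum_i y 0 i) ^+ 2.
    exact: (HQ (fun i => y 0 i)).
  have -> : y *m B *m y^T = y *m A *m y^T - k *: (y *m const_mx 1 *m y^T).
    by rewrite mulmxBr mulmxBl -scalemxAr -scalemxAl.
  rewrite mxE [X in _ + X]mxE [X in _ - X]mxE; congr (_ - _ * _).
    rewrite mxE exchange_big; apply: eq_bigr => j _ /=; rewrite !mxE mulr_suml.
    by apply: eq_bigr => i _; rewrite !mxE [_ * y 0 i]mulrC.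
  rewrite mxE (eq_bigr (fun j => (\sum_i y 0 i) * y 0 j)).
    by rewrite -mulr_sumr expr2.
  move=> j _; rewrite !mxE; congr (_ * _).
  by apply: eq_bigr => i _; rewrite mxE mulr1.
have sge x : x \in s -> - L <= x.
  move=> xs; have : x \in d%:R :: t.
    by rewrite (perm_mem pe) inE xs orbT.
  rewrite inE => /predU1P[->|/tL]; last by rewrite ler_norml => /andP[].
  by rewrite (le_trans _ (ler0n _ _)) // oppr_le0.
have s1s : s`_1 \in s by rewrite mem_nth // sz.
have sns : s`_n.-1 \in s by rewrite mem_nth // sz prednK // ltnW.
have mono i j : (i <= j)%N -> (j < n)%N -> s`_j <= s`_i.
  move=> ij jn; apply: (sorted_leq_nth ge_trans ge_refl) => //.
    by rewrite inE sz (leq_ltn_trans ij).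
  by rewrite inE sz.
(* Two entries of [s] above [L] would force two in [d :: t], where only [d] can exceed [L]. *)
have s1L : s`_1 <= L.
  rewrite leNgt; apply/negP => s1.
  have c2 : (1 < count (fun x => L < x)%R s)%N.
    have s0 : L < s`_0 by rewrite (lt_le_trans s1) // mono.
    by case: (s) (sz) s0 s1 n1 => [|a [|b s']] /= <- // -> ->.
  have c1 : (count (fun x => L < x)%R (d%:R :: t) <= 1)%N.
    have -> : count (fun x => L < x) (d%:R :: t) = (L < d%:R)%R :> nat.
      rewrite /= (eq_in_count (a2 := pred0)) ?count_pred0 ?addn0 //.
      by move=> x /tL; rewrite ler_norml leNgt => /andP[_]; rewrite leNgt => /negbTE.
    by case: (L < _).
  have /permP/(_ (fun x => L < x)) := pe; move: c1 c2 => /=; lia.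
by rewrite ge_max !ler_norml !sge //= s1L (le_trans _ s1L) // mono //; lia.
Qed.

(** * Fourier analysis on F^3 *)

(** The eight joint fibres are translates of the common kernel. *)
Lemma card_fibers_additive (F : finZmodType) (l0 l1 l2 : F -> bool) :
  (forall x y, l0 (x + y) = l0 x (+) l0 y) ->
  (forall x y, l1 (x + y) = l1 x (+) l1 y) ->
  (forall x y, l2 (x + y) = l2 x (+) l2 y) ->
  (forall a b c, exists x, [/\ l0 x = a, l1 x = b & l2 x = c]) ->
  forall a b c,
    (#|[set x | [&& l0 x == a, l1 x == b & l2 x == c]]| * 8 = #|F|)%N.
Proof.
move=> l0D l1D l2D surj.
pose fib a b c := [set x | [&& l0 x == a, l1 x == b & l2 x == c]].
have eqf a b c : #|fib a b c| = #|fib false false false|.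
  have [u [ua ub uc]] := surj a b c.
  have -> : fib a b c = [set x + u | x in fib false false false].
    apply/setP=> x; apply/idP/imsetP.
      rewrite inE => /and3P[/eqP xa /eqP xb /eqP xc]; exists (x - u); last by rewrite subrK.
      have xorK (d e : bool) : d = e (+) d -> e == false by case: d e => [] [].
      rewrite inE; apply/and3P; split.
      - by apply: (xorK a); rewrite -[in RHS]ua -l0D subrK.
      - by apply: (xorK b); rewrite -[in RHS]ub -l1D subrK.
      - by apply: (xorK c); rewrite -[in RHS]uc -l2D subrK.
    move=> [y]; rewrite !inE => /and3P[/eqP ya /eqP yb /eqP yc] ->.
    by rewrite l0D l1D l2D ya yb yc ua ub uc !addFb !eqxx.
  by rewrite card_imset //; exact: addIr.
move=> a b c; rewrite -/(fib a b c) eqf.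
pose g x := (l0 x, l1 x, l2 x).
rewrite -[RHS]sum1_card (partition_big g xpredT) //=.
rewrite (eq_bigr (fun=> #|fib false false false|)); last first.
  move=> [[a' b'] c'] _; rewrite -(eqf a' b' c') -sum1_card.
  by apply: eq_bigl => x; rewrite inE /g !xpair_eqE andbA.
by rewrite sum_nat_const !card_prod !card_bool mulnC.
Qed.

(** Three coordinates of [F], seen as an F_2-space of dimension [k]. *)
Lemma char2_field_functionals k : (3 <= k)%N ->
  exists (F : finFieldType) (l0 l1 l2 : F -> bool),
    [/\ #|F| = (2 ^ k)%N, forall x : F, x + x = 0,
        [/\ forall x y, l0 (x + y) = l0 x (+) l0 y,
            forall x y, l1 (x + y) = l1 x (+) l1 y
          & forall x y, l2 (x + y) = l2 x (+) l2 y]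
      & forall a b c, exists x, [/\ l0 x = a, l1 x = b & l2 x = c]].
Proof.
move=> k3; have k0 : (0 < k)%N by exact: leq_trans k3.
have [F charF cardF] := PrimePowerField (isT : prime 2) k0.
have [f flin [g fK gK]] := pprimeChar_vectAxiom charF.
have dimF : logn 2 #|F| = k by rewrite cardF pfactorK.
have bnd i : (i < 3)%N -> (i < logn 2 #|F|)%N by rewrite dimF => /leq_trans; apply.
pose l i (Hi : (i < 3)%N) (x : F) := f x 0 (Ordinal (bnd i Hi)) != 0.
have bD (a b : 'F_2) : (a + b != 0) = (a != 0) (+) (b != 0).
  by case: a b => [[|[|]] // ?] [[|[|]] // ?].
have lD i (Hi : (i < 3)%N) x y : l i Hi (x + y) = l i Hi x (+) l i Hi y.
  have := flin 1 x y; rewrite !scale1r /l => ->.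
  by rewrite mxE bD.
exists F, (l 0%N isT), (l 1%N isT), (l 2%N isT); split => //.
  by move=> x; rewrite -mulr2n -mulr_natr (pcharf0 charF) mulr0.
move=> a b c.
exists (g (\row_i (if i == 0%N :> nat then a else if i == 1%N :> nat then b else c)%:R)).
by rewrite /l !gK !mxE /=; split; [case: a|case: b|case: c].
Qed.

Section Fourier.
Variables (R : realFieldType) (F : finFieldType) (l : F -> bool).
Hypothesis char2 : forall x : F, x + x = 0.
Hypothesis lD : forall x y, l (x + y) = l x (+) l y.
Variable u : F.
Hypothesis lu : l u.

Let q : R := #|F|%:R.
(** In characteristic 2 additive characters are real. For a nonzero [l] the dilates of this one are
    all of them, so [l] need not be the trace. *)
Definition sgchar (x : F) : R := (-1) ^+ l x.

Definition dot3 (a x : F * F * F) : F :=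
  a.1.1 * x.1.1 + a.1.2 * x.1.2 + a.2 * x.2.

Definition fourier (f : F * F * F -> R) (a : F * F * F) : R :=
  \sum_x f x * sgchar (dot3 a x).

Lemma sgcharD x y : sgchar (x + y) = sgchar x * sgchar y.
Proof. by rewrite /sgchar lD signr_addb. Qed.

Lemma sgchar0 : sgchar 0 = 1.
Proof. by have := lD 0 0; rewrite addr0 /sgchar; case: (l 0). Qed.

Lemma sum_sgchar (a : F) : \sum_x sgchar (a * x) = q * (a == 0)%:R.
Proof.
have [->|a0] := eqVneq a 0.
  rewrite (eq_bigr (fun=> 1)) => [|x _]; last by rewrite mul0r sgchar0.
  by rewrite sumr_const mulr1.
(* Translation by u / a flips every sign. *)
have e : \sum_x sgchar (a * x) = - \sum_x sgchar (a * x).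
  rewrite [LHS](reindex_inj (addIr (u / a))) -sumrN; apply: eq_bigr => x _.
  by rewrite mulrDr mulrCA divff // mulr1 sgcharD {2}/sgchar lu expr1 mulrN1.
by rewrite mulr0; lra.
Qed.

Lemma sum_sgchar_dot3 (z : F * F * F) :
  \sum_a sgchar (dot3 a z) = q ^+ 3 * (z == 0)%:R.
Proof.
case: z => [[z1 z2] z3].
rewrite -(pair_bigA _ (fun a1 a3 => sgchar (dot3 (a1, a3) (z1, z2, z3)))) /=.
rewrite (eq_bigr (fun a => sgchar (z1 * a.1 + z2 * a.2) * (q * (z3 == 0)%:R))); last first.
  move=> a _; rewrite -sum_sgchar mulr_sumr; apply: eq_bigr => b _.
  by rewrite -sgcharD /dot3 /= ![z1 * _]mulrC ![z2 * _]mulrC ![z3 * _]mulrC.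
rewrite -mulr_suml -(pair_bigA _ (fun a b => sgchar (z1 * a + z2 * b))) /=.
rewrite (eq_bigr (fun a => sgchar (z1 * a) * (q * (z2 == 0)%:R))); last first.
  move=> a _; rewrite -sum_sgchar mulr_sumr; apply: eq_bigr => b _.
  by rewrite -sgcharD.
rewrite -mulr_suml sum_sgchar.
have -> : ((z1, z2, z3) == 0) = (z1 == 0) && (z2 == 0) && (z3 == 0) by [].
by do 3 case: (_ == 0); rewrite ?mulr1 ?mulr0 ?mul0r //; ring.
Qed.

(** The characters diagonalise the Cayley operator of [w]: after expanding the right side, summation
    over [a] leaves only y = x + z. *)
Lemma fourier_quad (w f : F * F * F -> R) :
  q ^+ 3 * (\sum_x \sum_z w z * f x * f (x + z))
    = \sum_a fourier w a * fourier f a ^+ 2.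
Proof.
transitivity (\sum_a \sum_x \sum_z \sum_y
    w z * f x * f y * sgchar (dot3 a (x + z + y))); last first.
  apply: eq_bigr => a _; rewrite {2}/fourier expr2 big_distrlr mulr_sumr.
  apply: eq_bigr => x _; rewrite /fourier mulr_suml; apply: eq_bigr => z _ /=.
  rewrite mulr_sumr; apply: eq_bigr => y _.
  have -> : dot3 a (x + z + y) = dot3 a z + dot3 a x + dot3 a y.
    by rewrite /dot3 /=; ring.
  by rewrite !sgcharD; ring.
rewrite [RHS]exchange_big mulr_sumr; apply: eq_bigr => x _.
rewrite [RHS]exchange_big mulr_sumr; apply: eq_bigr => z _.
have dbl (v : F * F * F) : v + v = 0.
  by case: v => [[v1 v2] v3]; congr (_, _, _); apply: char2.
have opp2 (v : F * F * F) : - v = v by apply/eqP; rewrite eq_sym -addr_eq0 dbl.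
rewrite [RHS]exchange_big (bigD1 (x + z)) //= [X in _ = _ + X]big1 ?addr0 => [|y yxz].
  by rewrite -mulr_sumr sum_sgchar_dot3 dbl eqxx mulr1 mulrC.
by rewrite -mulr_sumr sum_sgchar_dot3 -(opp2 y) subr_eq0 eq_sym (negbTE yxz) !mulr0.
Qed.

End Fourier.

(** Frequency 0 gives exactly the subtracted square. The other frequencies are bounded through
    Parseval, which is [fourier_quad] for the indicator of 0. *)
Lemma fourier_quad_bound (R : realFieldType) (F : finFieldType) (l : F -> bool)
    (w f : F * F * F -> R) (M : R) :
  (forall x : F, x + x = 0) -> (forall x y, l (x + y) = l x (+) l y) ->
  (exists u, l u) ->
  (forall a, a != 0 -> `|fourier l w a| <= M) ->
  `|\sum_x \sum_z w z * f x * f (x + z)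
     - (\sum_z w z) / #|F|%:R ^+ 3 * (\sum_x f x) ^+ 2| <= M * \sum_x f x ^+ 2.
Proof.
move=> char2 lD [u lu] wM; pose q : R := #|F|%:R.
have q1 : 0 < q by rewrite ltr0n; apply/card_gt0P; exists 0.
have q0 : 0 < q ^+ 3 by rewrite exprn_gt0.
have f0 g : fourier l g 0 = \sum_x g x.
  by apply: eq_bigr => x _; rewrite /dot3 !mul0r !addr0 sgchar0 // mulr1.
have pars : q ^+ 3 * \sum_x f x ^+ 2 = \sum_a fourier l f a ^+ 2.
  have := fourier_quad char2 lD lu (fun z => (z == 0)%:R) f.
  rewrite -/q (eq_bigr (fun x => f x ^+ 2)) => [->|x _].
    apply: eq_bigr => a _; rewrite /fourier (bigD1 (0 : F * F * F)) //= big1 ?addr0.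
      by rewrite eqxx !mul1r /dot3 !mulr0 !addr0 sgchar0 // mul1r.
    by move=> x /negbTE ->; rewrite mul0r.
  rewrite (bigD1 (0 : F * F * F)) //= big1 => [|z /negbTE ->]; last by rewrite !mul0r.
  by rewrite eqxx mul1r !addr0 expr2.
rewrite -/q -(ler_pM2l q0) -{1}(gtr0_norm q0) -normrM mulrBr.
rewrite (fourier_quad char2 lD lu) [leRHS]mulrCA pars (bigD1 (0 : F * F * F)) //= !f0.
have -> : q ^+ 3 * ((\sum_z w z) / q ^+ 3 * (\sum_x f x) ^+ 2)
    = (\sum_z w z) * (\sum_x f x) ^+ 2 by field; exact: lt0r_neq0.
rewrite addrAC subrr add0r (le_trans (ler_norm_sum _ _ _)) // mulr_sumr.
have M0 : 0 <= M.
  apply: le_trans (wM (u, 0, 0) _) => //; apply: contraTneq lu => -[->].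
  by have := lD 0 0; rewrite addr0; case: (l 0).
rewrite [leRHS](bigD1 (0 : F * F * F)) //=.
apply: ler_wpDl; first by rewrite mulr_ge0 ?sqr_ge0.
apply: ler_sum => a a0; rewrite normrM (ger0_norm (sqr_ge0 _)).
by rewrite ler_wpM2r ?sqr_ge0 // wM.
Qed.

Lemma card_cubic_fiber (F : finFieldType) (a b c x : F) :
  (a, b, c) != 0 ->
  (#|[set y | (a * y + b * y ^+ 2 + c * y ^+ 3 == x)%R]| <= 3)%N.
Proof.
move=> abc; pose p := Poly [:: - x; a; b; c].
have pE y : p.[y] = a * y + b * y ^+ 2 + c * y ^+ 3 - x.
  by rewrite horner_Poly /=; ring.
have p0 : p != 0.
  apply: contraNneq abc => p0.
  have pz i : p`_i = 0 by rewrite p0 coef0.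
  by move: (pz 1%N) (pz 2%N) (pz 3%N); rewrite !coef_Poly /= => -> -> ->.
rewrite cardE -ltnS; apply: leq_trans (size_Poly [:: - x; a; b; c]).
apply: max_poly_roots => //; last exact: enum_uniq.
by apply/allP=> y; rewrite mem_enum inE /root pE subr_eq0.
Qed.

(** * Eigenvalues of the Cayley graph on the conic set *)

Section Conic.
Variables (F : finFieldType) (l0 l1 l2 : F -> bool).
Hypothesis char2 : forall x : F, x + x = 0.
Hypothesis l0D : forall x y, l0 (x + y) = l0 x (+) l0 y.
Hypothesis l1D : forall x y, l1 (x + y) = l1 x (+) l1 y.
Hypothesis l2D : forall x y, l2 (x + y) = l2 x (+) l2 y.
Hypothesis lsurj : forall a b c, exists x, [/\ l0 x = a, l1 x = b & l2 x = c].

(** Codimension 3 makes the degrees small enough for the corrections along lines: they need at most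
    q/8 + 1 generators, and [line_pool] has q/4. *)
Definition coset8 (a : bool) : {set F} :=
  [set x | [&& l0 x == a, l1 x == false & l2 x == false]].

(** The multiple t y of the point (1, y, y^2) of a projective conic. *)
Definition conic (p : F * F) : F * F * F :=
  (p.1 * p.2, p.1 * p.2 ^+ 2, p.1 * p.2 ^+ 3).

Definition conic_set : {set F * F * F} :=
  [set conic p | p in setX (coset8 true) [set~ 0]].

Lemma l00 : l0 0 = false. Proof. by have := l0D 0 0; rewrite addr0; case: l0. Qed.

Lemma coset8_neq0 t : t \in coset8 true -> t != 0.
Proof. by rewrite inE => /and3P[/eqP lt _ _]; apply: contraTneq lt => ->; rewrite l00. Qed.

Lemma conic_inj : {in setX (coset8 true) [set~ 0] &, injective conic}.
Proof.
move=> [t y] [t' y'] /=; rewrite !inE /= => /andP[tT y0] /andP[tT' y0'] [e1 e2 _].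
have t0 : t != 0 by apply: coset8_neq0; rewrite inE.
have e : y = y'.
  apply: (mulfI (_ : t * y != 0)); first by rewrite mulf_neq0.
  by rewrite {2}e1 -!mulrA -!expr2.
by rewrite -e in e1 *; rewrite (mulIf y0 e1).
Qed.

Lemma sum_conic_set (R : nmodType) (g : F * F * F -> R) :
  \sum_(s in conic_set) g s
    = \sum_(y | y != 0) \sum_(t in coset8 true) g (conic (t, y)).
Proof.
rewrite /conic_set (big_imset _ conic_inj) /= exchange_big pair_big /=.
by apply: eq_big => [[t y]|[t y] _] //=; rewrite !inE.
Qed.

Lemma card_conic_set : #|conic_set| = (#|F|.-1 * #|coset8 true|)%N.
Proof. by rewrite (card_in_imset conic_inj) cardsX cardsC1 mulnC. Qed.

Section Eigenvalues.
Variable R : realFieldType.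
Let q : R := #|F|%:R.
Let chi := @sgchar R F l0.

(** [coset8 false] is a subgroup, so the character is either trivial on it or sums to 0 over it. *)
Lemma sum_chi_coset8_ge0 x : 0 <= \sum_(t in coset8 false) chi (t * x).
Proof.
have [/forallP all1|] := boolP [forall t in coset8 false, ~~ l0 (t * x)].
  apply: sumr_ge0 => t tK; rewrite /chi /sgchar.
  by have /implyP/(_ tK)/negbTE -> := all1 t.
rewrite negb_forall => /existsP[k]; rewrite negb_imply negbK => /andP[kK lk].
suff e : \sum_(t in coset8 false) chi (t * x) = - \sum_(t in coset8 false) chi (t * x).
  by rewrite le_eqVlt; apply/orP; left; apply/eqP; lra.
rewrite [LHS](reindex_inj (addIr k)) -sumrN; apply: eq_big => [t|t _].
  move: kK; rewrite !inE => /and3P[/eqP k0 /eqP k1 /eqP k2].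
  by rewrite l0D l1D l2D k0 k1 k2 !addbF.
by rewrite mulrDl /chi sgcharD // [X in _ * X]/sgchar lk expr1 mulrN1.
Qed.

Lemma sum_chi_coset8 x :
  `|\sum_(t in coset8 true) chi (t * x)| = \sum_(t in coset8 false) chi (t * x).
Proof.
have [u [u0 u1 u2]] := lsurj true false false.
rewrite (reindex_inj (addIr u)) /=.
transitivity `|\sum_(t in coset8 false) chi (t * x) * chi (u * x)|.
  congr `|_|; apply: eq_big => [t|t _]; last by rewrite mulrDl /chi sgcharD.
  by rewrite !inE l0D l1D l2D u0 u1 u2 !addbF addbT; case: (l0 t).
rewrite -mulr_suml normrM (ger0_norm (sum_chi_coset8_ge0 x)).
by rewrite /chi /sgchar normrX normrN1 expr1n mulr1.
Qed.

(** For fixed [y] the sum over [t] is, up to sign, the nonnegative [kap (P y)]. The cubic [P] takes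
    each value at most 3 times, and [kap] has total mass [q]. *)
Lemma fourier_conic_set a : a != 0 ->
  `|fourier l0 (fun s => (s \in conic_set)%:R : R) a| <= 3 * q.
Proof.
case: a => [[a b] c] abc; pose P y := a * y + b * y ^+ 2 + c * y ^+ 3.
pose kap x := \sum_(t in coset8 false) chi (t * x).
have -> : fourier l0 (fun s => (s \in conic_set)%:R : R) (a, b, c)
    = \sum_(y | y != 0) \sum_(t in coset8 true) chi (t * P y).
  rewrite /fourier (eq_bigr (fun y => \sum_(t in coset8 true)
      chi (dot3 (a, b, c) (conic (t, y))))).
    rewrite -(sum_conic_set (fun s => chi (dot3 (a, b, c) s))) [RHS]big_mkcond.
    by apply: eq_bigr => s _; case: (s \in _); rewrite ?mul1r ?mul0r.
  move=> y _; apply: eq_bigr => t _; congr chi.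
  by rewrite /dot3 /conic /P /=; ring.
apply: le_trans (ler_norm_sum _ _ _) _.
have kap0 x : 0 <= kap x := sum_chi_coset8_ge0 x.
apply: (@le_trans _ _ (\sum_y kap (P y))).
  rewrite [leRHS](bigID (fun y => y != 0)) /= ler_wpDr ?sumr_ge0 //.
  by apply: ler_sum => y _; rewrite sum_chi_coset8.
(* After exchanging the sums, only t = 0 in the subgroup contributes, with [q]. *)
have -> : 3 * q = \sum_x 3 * kap x.
  have [u [lu _ _]] := lsurj true false false.
  rewrite -mulr_sumr /kap exchange_big (bigD1 0) /=; last first.
    rewrite inE l00 /=.
    by have := l1D 0 0; have := l2D 0 0; rewrite addr0; case: (l1 0); case: (l2 0).
  rewrite (sum_sgchar R l0D lu) eqxx mulr1 big1 ?addr0 // => t /andP[_ t0].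
  by rewrite (sum_sgchar R l0D lu) (negbTE t0) mulr0.
rewrite (partition_big P xpredT) //=; apply: ler_sum => x _.
rewrite (eq_bigr (fun=> kap x)) => [|y /eqP -> //].
rewrite sumr_const -[leLHS]mulr_natl; apply: ler_wpM2r => //; rewrite ler_nat.
apply: leq_trans (card_cubic_fiber x abc); rewrite leq_eqVlt; apply/orP; left.
by apply/eqP; apply: eq_card => y; rewrite !inE.
Qed.
End Eigenvalues.
End Conic.

(** * The conic *)

Section ConicGeometry.
Variables (F : finFieldType) (l0 l1 l2 : F -> bool).
Hypothesis char2 : forall x : F, x + x = 0.
Hypothesis l0D : forall x y, l0 (x + y) = l0 x (+) l0 y.
Hypothesis l1D : forall x y, l1 (x + y) = l1 x (+) l1 y.
Hypothesis l2D : forall x y, l2 (x + y) = l2 x (+) l2 y.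
Hypothesis lsurj : forall a b c, exists x, [/\ l0 x = a, l1 x = b & l2 x = c].

Local Notation S := (conic_set l0 l1 l2).
Local Notation T := (coset8 l0 l1 l2 true).

Lemma opp_char2 (x : F) : - x = x.
Proof. by apply/eqP; rewrite eq_sym -addr_eq0 char2. Qed.

Lemma add3_char2 (x : F * F * F) : x + x = 0.
Proof. by case: x => [[a b] c]; congr (_, _, _); apply: char2. Qed.

Lemma conic_setP s :
  reflect (exists t y, [/\ t \in T, y != 0 & s = conic (t, y)]) (s \in S).
Proof.
apply: (iffP imsetP) => [[[t y]]|[t [y [tT y0 ->]]]].
  by rewrite !inE /= => /andP[tT y0] ->; exists t, y; rewrite inE.
by exists (t, y); rewrite // !inE /= y0 andbT; move: tT; rewrite inE.
Qed.

(** Hence no edge of the Cayley graph stays inside a plane of constant first coordinate. *)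
Lemma conic_set_neq0 s : s \in S -> s.1.1 != 0.
Proof.
by case/conic_setP=> t [y [/(coset8_neq0 l0D) t0 y0 ->]]; rewrite mulf_neq0.
Qed.

(* The columns (y, y^2, y^3) at distinct nonzero y are linearly independent, so
   a vanishing sum of three elements must use a single y, and then vanishing of
   the sum of the three coefficients contradicts [l0 t = true]. *)
Lemma conic_set_sum3 s1 s2 s3 :
  s1 \in S -> s2 \in S -> s3 \in S -> s1 + s2 + s3 != 0.
Proof.
case/conic_setP=> t1 [y1 [t1T y10 ->]].
case/conic_setP=> t2 [y2 [t2T y20 ->]].
case/conic_setP=> t3 [y3 [t3T y30 ->]].
apply/eqP => -[e1 e2 e3].
have vdm t1' y1' t2' y2' t3' y3' : t3' \in T -> y3' != 0 ->
    t1' * y1' + t2' * y2' + t3' * y3' = 0 ->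
    t1' * y1' ^+ 2 + t2' * y2' ^+ 2 + t3' * y3' ^+ 2 = 0 ->
    t1' * y1' ^+ 3 + t2' * y2' ^+ 3 + t3' * y3' ^+ 3 = 0 ->
    (y3' == y1') || (y3' == y2').
  move=> /(coset8_neq0 l0D) t0 y0 f1 f2 f3.
  (* Combining the equations with the coefficients of (Y - y1')(Y - y2') eliminates the first two
     columns. *)
  have : t3' * y3' * ((y3' - y1') * (y3' - y2')) = 0.
    transitivity ((t1' * y1' ^+ 3 + t2' * y2' ^+ 3 + t3' * y3' ^+ 3)
      - (y1' + y2') * (t1' * y1' ^+ 2 + t2' * y2' ^+ 2 + t3' * y3' ^+ 2)
      + y1' * y2' * (t1' * y1' + t2' * y2' + t3' * y3')); first by ring.
    by rewrite f1 f2 f3; ring.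
  by move/eqP; rewrite !mulf_eq0 (negbTE t0) (negbTE y0) /= !subr_eq0.
have h3 := vdm _ _ _ _ _ _ t3T y30 e1 e2 e3.
have h1 : (y1 == y2) || (y1 == y3).
  by apply: (vdm t2 y2 t3 y3 t1 y1) => //; rewrite addrC addrA.
have h2 : (y2 == y1) || (y2 == y3).
  by apply: (vdm t1 y1 t3 y3 t2 y2) => //; rewrite addrAC.
have [e21 e31] : y2 = y1 /\ y3 = y1.
  by case/orP: h3 h1 h2 => /eqP->; rewrite ?orbb; [move=> _|move=> + _] => /eqP ->.
move: e1; rewrite e21 e31 -!mulrDl => /eqP.
rewrite mulf_eq0 (negbTE y10) orbF => /eqP t0.
have := congr1 l0 t0; rewrite !l0D l00 //.
by move: t1T t2T t3T; rewrite !inE => /and3P[/eqP-> _ _]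
  /and3P[/eqP-> _ _] /and3P[/eqP->].
Qed.

(* In characteristic 2 all tangents of the conic meet in the nucleus
   (0, 1, 0), which therefore lies on no secant. *)
Lemma conic_set_nucleus s1 s2 b :
  s1 \in S -> s2 \in S -> s1 + s2 = (0, b, 0) -> b = 0.
Proof.
case/conic_setP=> t1 [y1 [/(coset8_neq0 l0D) t10 y10 ->]].
case/conic_setP=> t2 [y2 [_ y20 ->]] -[e1 <- e3].
have {}e1 : t2 * y2 = t1 * y1 by apply/eqP; rewrite eq_sym -subr_eq0 opp_char2 e1.
have : t1 * y1 * (y1 - y2) ^+ 2 = 0.
  transitivity (t1 * y1 ^+ 3 + t2 * y2 * y2 ^+ 2).
    rewrite e1 sqrrB -mulr_natr mulrDr mulrDr -[2%:R]/(1 + 1) char2.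
    rewrite mulr0 oppr0 mulr0 addr0.
    by ring.
  by rewrite -e3; ring.
move/eqP; rewrite mulf_eq0 [X in X || _]mulf_eq0 (negbTE t10) (negbTE y10).
rewrite expf_eq0 subr_eq0 => /eqP e.
by move: e1; rewrite -e => /(mulIf y10) ->; exact: char2.
Qed.

(** Each [t] determines y = a / t. Every point therefore has equally many Cayley neighbours in each
    plane other than its own. *)
Lemma card_conic_set_slice a : a != 0 ->
  #|[set s in S | s.1.1 == a]| = #|T|.
Proof.
move=> a0; pose f t : F * F * F := conic (t, a / t).
have fE t : t \in T -> (f t).1.1 = a.
  by move=> /(coset8_neq0 l0D) t0; rewrite /f /= mulrC divfK.
suff -> : [set s in S | s.1.1 == a] = [set f t | t in T].
  rewrite card_in_imset // => t t' tT t'T [_ + _].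
  have /(coset8_neq0 l0D) t0 := tT; have /(coset8_neq0 l0D) t0' := t'T.
  move: (fE _ tT) (fE _ t'T); rewrite /f /= !expr2 !mulrA => -> ->.
  by rewrite -!mulrA => /(mulfI a0) /(mulfI a0) /invr_inj.
apply/setP=> s; apply/idP/imsetP => [|[t tT ->]].
  rewrite inE => /andP[/conic_setP[t [y [tT y0 ->]]] /eqP /= e]; exists t => //.
  by rewrite /f -e mulrAC divff ?mul1r // (coset8_neq0 l0D tT).
rewrite inE fE // eqxx andbT; apply/conic_setP; exists t, (a / t).
by rewrite mulf_neq0 ?invr_eq0 // (coset8_neq0 l0D tT).
Qed.

Lemma card_coset8 a : (#|coset8 l0 l1 l2 a| * 8 = #|F|)%N.
Proof. exact: card_fibers_additive. Qed.

(** Generators available for correcting degrees along lines; [l0] makes the pool sum-free and [l1]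
    separates it from the later [h]. *)
Definition line_pool : {set F} := [set x | l0 x & ~~ l1 x].
(* Subdivision vertices are attached inside [line_kernel]: it is invariant under
   [h] and no two of its elements differ by an element of [line_pool]. *)
Definition line_kernel : {set F} := [set x | ~~ l0 x].

Lemma card_line_pool : (#|line_pool| * 4 = #|F|)%N.
Proof.
have e b : (#|[set x | [&& l0 x == true, l1 x == false & l2 x == b]]| * 8 = #|F|)%N.
  exact: card_fibers_additive.
have -> : line_pool = [set x | [&& l0 x == true, l1 x == false & l2 x == true]]
   :|: [set x | [&& l0 x == true, l1 x == false & l2 x == false]].
  by apply/setP=> x; rewrite !inE; case: l0; case: l1; case: l2.
rewrite cardsU (_ : _ :&: _ = set0) ?cards0 ?subn0.
  by move: (e true) (e false) => {e}; lia.
by apply/setP=> x; rewrite !inE; case: l0; case: l1; case: l2.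
Qed.

Lemma card_line_kernel : (#|line_kernel| * 2 = #|F|)%N.
Proof.
have [u [u0 _ _]] := lsurj true false false.
have e : #|line_kernel| = #|~: line_kernel|.
  rewrite -(card_imset (mem line_kernel) (addIr u)); apply: eq_card => x.
  apply/imsetP/idP => [[y]|]; rewrite !inE ?negbK.
    by move=> y0 ->; rewrite l0D u0 addbT.
  by move=> x0; exists (x + u); rewrite ?inE ?l0D ?u0 ?x0 // -addrA char2 addr0.
by rewrite -[RHS](cardsC line_kernel) -e muln2 addnn.
Qed.

End ConicGeometry.

(** * Perturbation bounds and transport to ordinals *)

(* AM-GM: [2 |f g| <= al f^2 + g^2 / al]. *)
Lemma bilinear_amgm (R : realFieldType) (A B : finType) (e : A -> B -> bool)
    (f : A -> R) (g : B -> R) (al r1 r2 : R) :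
  0 < al ->
  (forall x, \sum_y (e x y)%:R <= r1) -> (forall y, \sum_x (e x y)%:R <= r2) ->
  2 * `|\sum_x \sum_y (e x y)%:R * f x * g y|
    <= al * r1 * \sum_x f x ^+ 2 + r2 / al * \sum_y g y ^+ 2.
Proof.
move=> al0 h1 h2; set s := \sum_x _.
have pt x y : 2 * `|(e x y)%:R * f x * g y|
    <= (e x y)%:R * (al * f x ^+ 2) + (e x y)%:R * (g y ^+ 2 / al).
  case: (e x y); last by rewrite !mul0r normr0 mulr0 addr0.
  rewrite !mul1r normrM -[f x ^+ 2]real_normK ?num_real //.
  rewrite -[g y ^+ 2]real_normK ?num_real //; set a := `|f x|; set b := `|g y|.
  rewrite -subr_ge0.
  have -> : al * a ^+ 2 + b ^+ 2 / al - 2 * (a * b) = (al * a - b) ^+ 2 / al.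
    by field; exact: lt0r_neq0.
  by rewrite divr_ge0 ?sqr_ge0 // ltW.
apply: (@le_trans _ _ (\sum_x \sum_y
    ((e x y)%:R * (al * f x ^+ 2) + (e x y)%:R * (g y ^+ 2 / al)))).
  apply: (@le_trans _ _ (\sum_x \sum_y 2 * `|(e x y)%:R * f x * g y|)).
    rewrite /s (eq_bigr _ (fun x _ => esym (mulr_sumr _ _ _ _))) -mulr_sumr.
    rewrite ler_pM2l // (le_trans (ler_norm_sum _ _ _)) //.
    by apply: ler_sum => x _; exact: ler_norm_sum.
  by do 2 (apply: ler_sum => ? _).
under eq_bigr do rewrite big_split /= -!mulr_suml.
rewrite big_split /=; apply: lerD.
  rewrite mulr_sumr; apply: ler_sum => x _; rewrite [al * r1]mulrC -mulrA.
  by rewrite ler_wpM2r // mulr_ge0 ?sqr_ge0 // ltW.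
rewrite exchange_big mulr_sumr /=; apply: ler_sum => y _.
rewrite -mulr_suml (mulrAC r2) -(mulrA r2).
by rewrite ler_wpM2r // mulr_ge0 ?sqr_ge0 // invr_ge0 ltW.
Qed.

Lemma sgraph_of_rel (R : realType) (U : finType) (W : {set U}) (E : rel U)
    (n d : nat) (k L : R) :
  (1 < n)%N -> #|W| = n -> symmetric E -> {in W, irreflexive E} ->
  {in W, forall u, #|[set v in W | E u v]| = d} ->
  {in W & W & W, forall u v w, ~~ [&& E u v, E v w & E u w]} ->
  0 <= L ->
  (forall f : U -> R,
     `|\sum_(u in W) \sum_(v in W) (E u v)%:R * f u * f v
       - k * (\sum_(u in W) f u) ^+ 2| <= L * \sum_(u in W) f u ^+ 2) ->
  exists G : sgraph n, [/\ regular G d, triangle_free G & graph_lambda R G <= L].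
Proof.
move=> n1 cW Esym Eirr Ereg Etri L0 EQ.
pose v (i : 'I_n) : U := enum_val (cast_ord (esym cW) i).
have vW i : v i \in W by exact: enum_valP.
have vi : injective v by move=> i j /enum_val_inj /cast_ord_inj.
have Wv u : u \in W -> exists i, u = v i.
  move=> uW; exists (cast_ord cW (enum_rank_in uW u)).
  by rewrite /v cast_ordK enum_rankK_in.
have imv : v @: setT = W.
  apply/setP=> u; apply/imsetP/idP => [[i _ ->]//|/Wv[i ->]].
  by exists i.
have reidx (V : nmodType) (g : U -> V) : \sum_i g (v i) = \sum_(u in W) g u.
  by rewrite -imv (big_imset g (in2W vi)); apply: eq_bigl => i; rewrite inE.
have vsym : symmetric (fun i j => E (v i) (v j)) by move=> i j; exact: Esym.
have virr : irreflexive (fun i j => E (v i) (v j)) by move=> i; apply: Eirr.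
pose G := SGraph vsym virr.
have Greg : regular G d.
  move=> i; rewrite -(Ereg (v i)) // -(card_imset _ vi).
  apply: eq_card => u; rewrite inE; apply/imsetP/andP => [[j]|[/Wv[j ->] Eij]].
    by rewrite inE => Eij ->.
  by exists j; rewrite ?inE.
exists G; split=> //; first by move=> i j l; exact: Etri.
apply: (graph_lambda_le (k := k) n1 Greg L0) => x.
(* Extends [x] by zero outside the image of [v]. *)
pose f u := \sum_(i | v i == u) x i.
have fv i : f (v i) = x i.
  by rewrite /f (big_pred1 i) // => j; rewrite (inj_eq vi).
have := EQ f; rewrite -!reidx.
under eq_bigr do rewrite -reidx; under eq_bigr do under eq_bigr do rewrite !fv.
under [X in k * X ^+ 2]eq_bigr do rewrite fv.
by under [X in L * X]eq_bigr do rewrite fv.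
Qed.

(** Orbits of [s] have two elements and are added one at a time. *)
Lemma invariant_subset (T : finType) (s : T -> T) (X : {set T}) (m : nat) :
  involutive s -> (forall x, s x != x) -> {in X, forall x, s x \in X} ->
  (m * 2 <= #|X|)%N ->
  exists Y : {set T},
    [/\ Y \subset X, {in Y, forall x, s x \in Y} & #|Y| = (m * 2)%N].
Proof.
move=> sK sN sX; elim: m => [|m IH] mX.
  by exists set0; split; rewrite ?sub0set ?cards0 // => x; rewrite inE.
have [|Y [YX sY cY]] := IH; first by lia.
have [x] : exists x, x \in X :\: Y.
  by apply/card_gt0P; rewrite cardsD (setIidPr YX) cY; lia.
rewrite inE => /andP[xY xX].
have sxY : s x \notin Y by apply: contra xY => /sY; rewrite sK.
exists (x |: (s x |: Y)); split.
- by rewrite !subUset !sub1set xX sX.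
- move=> y; rewrite !inE => /or3P[/eqP->|/eqP->|/sY->]; rewrite ?sK ?eqxx ?orbT //.
- by rewrite !cardsU1 !inE (negbTE xY) (negbTE sxY) eq_sym (negbTE (sN x)) cY; lia.
Qed.

(** Cauchy-Schwarz, as [bilinear_amgm] for the full relation. *)
Lemma sqr_sum_le (R : realFieldType) (A : finType) (f : A -> R) :
  (\sum_x f x) ^+ 2 <= #|A|%:R * \sum_x f x ^+ 2.
Proof.
have cnt (x : A) : \sum_(y : A) true%:R <= #|A|%:R :> R by rewrite sumr_const.
have := bilinear_amgm (e := fun _ _ => true) f f ltr01 cnt cnt.
have -> : \sum_x \sum_y true%:R * f x * f y = (\sum_x f x) ^+ 2.
  by rewrite expr2 big_distrlr; do 2 apply: eq_bigr => ? _; rewrite mul1r.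
by rewrite ger0_norm ?sqr_ge0 // mul1r divr1; clear cnt; lra.
Qed.

(** Bounds what the inserted vertices add to the rank-one term: [a] is the sum over old vertices and
    [b] over inserted ones. The product is controlled by the squares of a + q b and a - q b. *)
Lemma rank1_correction (R : realFieldType) (q k a b A B : R) :
  0 < q -> 0 <= k -> k * q <= 1 -> a ^+ 2 <= q ^+ 3 * A -> b ^+ 2 <= q * B ->
  `|k * (2 * a * b + b ^+ 2)| <= q * A + (q + 1) * B.
Proof.
move=> q0 k0 kq ha hb; rewrite normrM (ger0_norm k0).
have hq : q ^+ 2 * b ^+ 2 <= q ^+ 3 * B.
  by rewrite (exprSr q 2) -mulrA ler_wpM2l // sqr_ge0.
have h1 : `|2 * a * b| <= q ^+ 2 * A + q ^+ 2 * B.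
  rewrite -(ler_pM2l q0) -{1}(gtr0_norm q0) -normrM ler_norml.
  have := sqr_ge0 (a - q * b); have := sqr_ge0 (a + q * b).
  have -> : (a + q * b) ^+ 2 = a ^+ 2 + q ^+ 2 * b ^+ 2 + q * (2 * a * b) by ring.
  have -> : (a - q * b) ^+ 2 = a ^+ 2 + q ^+ 2 * b ^+ 2 - q * (2 * a * b) by ring.
  have -> : q * (q ^+ 2 * A + q ^+ 2 * B) = q ^+ 3 * A + q ^+ 3 * B by ring.
  by move=> p1 p2; apply/andP; split; lra.
have h2 : `|2 * a * b + b ^+ 2| <= q * (q * A + (q + 1) * B).
  apply: le_trans (ler_normD _ _) _; rewrite (ger0_norm (sqr_ge0 b)).
  have -> : q * (q * A + (q + 1) * B) = (q ^+ 2 * A + q ^+ 2 * B) + q * B by ring.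
  exact: lerD.
apply: le_trans (ler_wpM2l k0 h2) _; rewrite mulrA.
have : 0 <= q * (q * A + (q + 1) * B) by exact: le_trans (normr_ge0 _) h2.
by rewrite pmulr_rge0 // => s0; rewrite -[leRHS]mul1r ler_wpM2r.
Qed.

(** * The graph *)

Section Construction.
Variables (F : finFieldType) (l0 l1 l2 : F -> bool).
Hypothesis char2 : forall x : F, x + x = 0.
Hypothesis l0D : forall x y, l0 (x + y) = l0 x (+) l0 y.
Hypothesis l1D : forall x y, l1 (x + y) = l1 x (+) l1 y.
Hypothesis l2D : forall x y, l2 (x + y) = l2 x (+) l2 y.
Hypothesis lsurj : forall a b c, exists x, [/\ l0 x = a, l1 x = b & l2 x = c].
Variable h : F.
Hypotheses (l0h : l0 h = false) (l1h : l1 h = true).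

Local Notation S := (conic_set l0 l1 l2).
Local Notation K := #|coset8 l0 l1 l2 true|.
Local Notation P := (line_pool l0 l1).

Variables c c' r : nat.
Hypothesis c_lt : (c < #|F|)%N.
Hypothesis c'_lt : (c' < #|F|)%N.

(** Neighbourhoods of the inserted vertices. [I_same], [I_kernel] and the removal of [h]-edges make
    them independent; by [I_shift] and [I_disj] each attached point loses one edge and gains one. *)
Variable I : 'I_r -> {set F * F * F}.
Hypothesis I_part : forall j x, x \in I j -> (enum_rank x.1.1 < c)%N.
Hypothesis I_kernel : forall j x, x \in I j -> ~~ l0 x.1.2.
Hypothesis I_same : forall j x y, x \in I j -> y \in I j -> x.1.1 = y.1.1.
Hypothesis I_shift : forall j x, x \in I j -> x + (0, h, 0) \in I j.
Hypothesis I_card : forall j, #|I j| = (c * K + 2)%N.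
Hypothesis I_disj : forall i j x, x \in I i -> x \in I j -> i = j.

Definition old : {set F * F * F} :=
  [set x | (enum_rank x.1.1 < c)%N
           || (enum_rank x.1.1 == c :> nat) && (enum_rank x.2 < c')%N].

(* By translation invariance along lines, the number of neighbours in [old] of
   any (a, b, z). *)
Definition cross_degree (a z : F) : nat := #|[set y in old | (a, 0, z) + y \in S]|.

(** Raises the degree to cK + 1. One more edge, along [h] or to an inserted vertex, completes it to
    cK + 2. *)
Definition line_gens (a z : F) : {set F} :=
  [set x in take (c * K + 1 - cross_degree a z) (enum P)].

Definition attached : {set F * F * F} := \bigcup_j I j.

(** Testing [attached] at [x] alone still gives a symmetric relation, since [attached] is invariant
    under [h]. *)
Definition line_edge (x y : F * F * F) : bool :=
  [&& x.1.1 == y.1.1, x.2 == y.2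
    & (x.1.2 + y.1.2 \in line_gens x.1.1 x.2)
      || (x.1.2 + y.1.2 == h) && (x \notin attached)].

(* [inr j] is the j-th subdivision vertex. *)
Definition edge (u v : F * F * F + 'I_r) : bool :=
  match u, v with
  | inl x, inl y => (x + y \in S) || line_edge x y
  | inl x, inr j | inr j, inl x => x \in I j
  | inr _, inr _ => false
  end.

Definition vertices : {set F * F * F + 'I_r} :=
  [set u | if u is inl x then x \in old else true].

(** * Counting vertices and neighbours *)

Lemma card_rank_interval m w : (m + w <= #|F|)%N ->
  #|[set a : F | (m <= enum_rank a < m + w)%N]| = w.
Proof.
move=> mw; have bnd (i : 'I_w) : (m + i < #|F|)%N.
  by rewrite (leq_trans _ mw) // ltn_add2l.
pose f i := enum_val (Ordinal (bnd i)).
have -> : [set a : F | (m <= enum_rank a < m + w)%N] = f @: setT.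
  apply/setP=> a; rewrite inE; apply/andP/imsetP => [[ma aw]|[i _ ->]].
    have iw : (enum_rank a - m < w)%N by rewrite ltn_subLR.
    exists (Ordinal iw) => //; rewrite /f; apply: enum_rank_inj.
    by rewrite enum_valK; apply: val_inj; rewrite /= subnKC.
  by rewrite /f enum_valK /= leq_addr ltn_add2l.
rewrite card_imset ?cardsT ?card_ord // => i j /enum_val_inj [] /eqP.
by rewrite eqn_add2l => /eqP /val_inj.
Qed.

Lemma card_rank_lt m : (m <= #|F|)%N -> #|[set a : F | (enum_rank a < m)%N]| = m.
Proof. by move=> mF; rewrite -[RHS](@card_rank_interval 0 m). Qed.

Lemma card_old : #|old| = (c * #|F| ^ 2 + c' * #|F|)%N.
Proof.
pose A := [set a : F | (enum_rank a < c)%N].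
pose B := [set a : F | (c <= enum_rank a < c + 1)%N].
pose C := [set z : F | (enum_rank z < c')%N].
have -> : old = setX (setX A setT) setT :|: setX (setX B setT) C.
  apply/setP=> [[[a b] z]]; rewrite !inE /= !andbT addn1 ltnS.
  by rewrite [_ == c :> nat]eqn_leq [(_ <= c)%N && _]andbC.
rewrite cardsU [_ :&: _](_ : _ = set0) ?cards0 ?subn0; last first.
  by apply/setP=> [[[a b] z]]; rewrite !inE /= !andbT ltnNge; case: (c <= enum_rank a)%N.
rewrite !cardsX !cardsT !card_rank_lt ?card_rank_interval ?addn1 // 1?ltnW //.
by rewrite mul1n -mulnA mulnn [in RHS](mulnC c').
Qed.

Lemma card_vertices : #|vertices| = (c * #|F| ^ 2 + c' * #|F| + r)%N.
Proof.
rewrite -card_old -sum1_card big_sumType /=; congr (_ + _)%N.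
  by rewrite -sum1_card; apply: eq_bigl => x; rewrite inE.
by rewrite -[RHS]card_ord -sum1_card; apply: eq_bigl => x; rewrite inE.
Qed.

Lemma card_slice x a : x.1.1 != a ->
  #|[set y | (x + y \in S) && (y.1.1 == a)]| = K.
Proof.
move=> xa; rewrite -(@card_conic_set_slice _ l0 l1 l2 l0D (x.1.1 + a)); last first.
  by rewrite -(opp_char2 char2 a) subr_eq0.
rewrite -(card_imset _ (addrI x)); apply: eq_card => s.
apply/imsetP/idP => [[y]|]; rewrite !inE.
  by move=> /andP[yS /eqP ya] ->; rewrite yS -ya eqxx.
move=> /andP[sS /eqP sa]; exists (x + s); last first.
  by rewrite addrA (add3_char2 char2) add0r.
rewrite inE addrA (add3_char2 char2) add0r sS -[_.1.1]/(x.1.1 + s.1.1) sa.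
by rewrite addrA char2 add0r eqxx.
Qed.

(** [old] is a union of lines, so it is invariant under translation by (0, b, 0). *)
Lemma cross_degreeE x : #|[set y in old | x + y \in S]| = cross_degree x.1.1 x.2.
Proof.
case: x => [[a b] z]; rewrite /cross_degree /=.
rewrite -[LHS](card_imset _ (addrI (0, b, 0))); apply: eq_card => y.
have e w : (a, b, z) + w = (a, 0, z) + ((0, b, 0) + w).
  by rewrite addrA; congr (_ + _); congr (_, _, _); rewrite /= ?addr0 ?add0r.
have oldE w : ((0, b, 0) + w \in old) = (w \in old) by rewrite !inE /= !add0r.
have inA v (B : {set F * F * F}) : (v \in [set y in B | (a, 0, z) + y \in S])
  = (v \in B) && ((a, 0, z) + v \in S) by rewrite in_set.
rewrite inA; apply/imsetP/andP => [[w + ->]|[yo yS]].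
  by rewrite in_set e oldE => /andP.
exists ((0, b, 0) + y); last by rewrite addrA (add3_char2 char2) add0r.
by rewrite in_set e (addrA (0, b, 0)) (add3_char2 char2) add0r oldE yo.
Qed.

(** Neighbours lie in other planes, [K] in each full one. At least c - 1 full planes and at most [c]
    planes meeting [old] differ from that of [x]. *)
Lemma cross_degree_bounds x : x \in old ->
  ((c - 1) * K <= cross_degree x.1.1 x.2 <= c * K)%N.
Proof.
move=> xo; rewrite -cross_degreeE.
pose D a := #|[set y | (x + y \in S) && (y.1.1 == a)]|.
have D_K a : x.1.1 != a -> D a = K by exact: card_slice.
have nS y : x + y \in S -> x.1.1 != y.1.1.
  move=> /(conic_set_neq0 l0D); apply: contra => /eqP e.
  by rewrite -[_.1.1]/(x.1.1 + y.1.1) e char2.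
have c1 : #|[set a : F | (enum_rank a < c.+1)%N] :\ x.1.1| = c.
  have := cardsD1 x.1.1 [set a : F | (enum_rank a < c.+1)%N].
  rewrite card_rank_lt // inE; move: xo; rewrite inE.
  by case/orP=> [h1|/andP[/eqP-> _]]; rewrite ?ltnSn ?ltnS ?(ltnW h1) // => -[].
have c0 : (c - 1 <= #|[set a : F | (enum_rank a < c)%N] :\ x.1.1|)%N.
  have := cardsD1 x.1.1 [set a : F | (enum_rank a < c)%N].
  by rewrite (card_rank_lt (ltnW c_lt)) leq_subLR => {1}->; rewrite leq_add2r leq_b1.
apply/andP; split.
  apply: leq_trans (leq_mul c0 (leqnn _)) _.
  rewrite -sum_nat_const -[leqRHS]sum1_card.
  rewrite (bigID (fun y =>
    y.1.1 \in [set a : F | (enum_rank a < c)%N] :\ x.1.1)) /=.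
  apply: leq_trans (leq_addr _ _).
  rewrite (partition_big (fun y => y.1.1)
    (fun a => a \in [set a : F | (enum_rank a < c)%N] :\ x.1.1)); last first.
    by move=> y /andP[].
  apply: leq_sum => a aA; rewrite -(D_K a); last first.
    by move: aA; rewrite !inE eq_sym => /andP[].
  rewrite /D -sum1_card; apply: eq_leq; apply: eq_bigl => y; rewrite !inE.
  have [ya|] := eqVneq y.1.1 a; rewrite ?andbF ?andbT //.
  by move: aA; rewrite !inE ya => /andP[-> ->]; rewrite !andbT.
rewrite -[X in (_ <= X * _)%N]c1 -sum_nat_const -[leqLHS]sum1_card.
rewrite (partition_big (fun y => y.1.1)
  (fun a => a \in [set a : F | (enum_rank a < c.+1)%N] :\ x.1.1)); last first.
  move=> y; rewrite !inE => /andP[yo /nS xy]; rewrite eq_sym xy /= ltnS.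
  by case/orP: yo => [/ltnW//|/andP[/eqP->]].
apply: leq_sum => a aA; rewrite -(D_K a); last first.
  by move: aA; rewrite !inE eq_sym => /andP[].
rewrite sum1_card; apply: subset_leq_card; apply/subsetP=> y.
by rewrite unfold_in !inE => /andP[/andP[_ ->] ->].
Qed.

(** The request is at most K + 1, and the pool has 2K elements, so [take] is never cut short. *)
Lemma card_line_gens x : x \in old ->
  #|line_gens x.1.1 x.2| = (c * K + 1 - cross_degree x.1.1 x.2)%N.
Proof.
move=> /cross_degree_bounds/andP[lo _].
have cK : (#|coset8 l0 l1 l2 true| * 8 = #|F|)%N := card_coset8 l0D l1D l2D lsurj true.
have cP : (#|line_pool l0 l1| * 4 = #|F|)%N := card_line_pool l0D l1D l2D lsurj.
have F0 : (0 < #|F|)%N by apply/card_gt0P; exists 0.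
rewrite /line_gens cardsE (card_uniqP (take_uniq _ (enum_uniq _))) size_takel //.
by rewrite -cardE; move: lo; rewrite mulnBl mul1n; lia.
Qed.

(** * Symmetry, triangle-freeness and regularity *)

Lemma line_gens_pool a z x : x \in line_gens a z -> x \in P.
Proof. by rewrite inE => /mem_take; rewrite mem_enum. Qed.

Lemma pool_shift x : x \in P -> (x == h) = false.
Proof. by rewrite inE => /andP[lx _]; apply/negP => /eqP e; rewrite e l0h in lx. Qed.

Lemma shiftK : involutive (fun x : F * F * F => x + (0, h, 0)).
Proof. by move=> x; rewrite -addrA (add3_char2 char2) addr0. Qed.

Lemma attachedP x : reflect (exists j, x \in I j) (x \in attached).
Proof.
apply: (iffP bigcupP) => [[j _ xj]|[j xj]]; first by exists j.
by exists j.
Qed.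

Lemma attached_shift x : (x + (0, h, 0) \in attached) = (x \in attached).
Proof.
apply/attachedP/attachedP => -[j xj]; exists j; last exact: I_shift.
by rewrite -(shiftK x); apply: I_shift.
Qed.

Lemma line_edgeP x y : line_edge x y ->
  exists2 d, x + y = (0, d, 0) & (d \in P) || (d == h) && (x \notin attached).
Proof.
case/and3P=> /eqP e1 /eqP e2 e3; exists (x.1.2 + y.1.2).
  by case: x y e1 e2 {e3} => [[a b] z] [[a' b'] z'] /= -> ->;
    congr (_, _, _); apply: char2.
by case/orP: e3 => [/line_gens_pool->|->]; rewrite ?orbT.
Qed.

Lemma line_edge_sym : symmetric line_edge.
Proof.
suff sub x y : line_edge x y -> line_edge y x by move=> x y; apply/idP/idP; exact: sub.
move=> /[dup] /line_edgeP[d exy _] /and3P[/eqP e1 /eqP e2 e3].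
rewrite /line_edge -e1 -e2 !eqxx /= [y.1.2 + _]addrC.
case/orP: e3 => [->//|/andP[/eqP e xI]]; rewrite e eqxx.
suff -> : y = x + (0, h, 0) by rewrite attached_shift xI orbT.
have ed : d = h by have := congr1 (fun v => v.1.2) exy; rewrite /= => <-.
by rewrite -ed -exy addrA (add3_char2 char2) add0r.
Qed.

Lemma edge_sym : symmetric edge.
Proof.
by move=> [x|i] [y|j] //=; rewrite line_edge_sym addrC.
Qed.

Lemma line_edge_irr : irreflexive line_edge.
Proof.
move=> x; apply/negP => /line_edgeP[d]; rewrite (add3_char2 char2) => -[<-].
rewrite inE (l00 l0D) /= => /andP[/eqP h0 _].
by move: l1h; rewrite -h0; have := l1D 0 0; rewrite addr0; case: (l1 0).
Qed.

Lemma cross_line x y : line_edge x y -> x + y \notin S.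
Proof.
by case/line_edgeP=> d -> _; apply/negP => /(conic_set_neq0 l0D); rewrite eqxx.
Qed.

Lemma edge_irr : irreflexive edge.
Proof.
move=> [x|//] /=; rewrite line_edge_irr orbF (add3_char2 char2).
by apply/negP => /(conic_set_neq0 l0D); rewrite eqxx.
Qed.

(** A common plane excludes [S], vanishing of [l0] excludes [line_pool], and [h]-edges are removed
    at attached points. *)
Lemma edge_attached j x y : x \in I j -> y \in I j -> ~~ edge (inl x) (inl y).
Proof.
move=> xj yj /=; rewrite negb_or; apply/andP; split.
  apply/negP => /(conic_set_neq0 l0D).
  by rewrite -[_.1.1]/(x.1.1 + y.1.1) (I_same xj yj) char2 eqxx.
apply/negP => /line_edgeP[d exy]; have xA : x \in attached by apply/attachedP; exists j.
rewrite xA andbF orbF inE => /andP[ld _].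
have : l0 d = false by have := congr1 (fun v => l0 v.1.2) exy; rewrite /= => <-;
  rewrite l0D (negbTE (I_kernel xj)) (negbTE (I_kernel yj)).
by rewrite ld.
Qed.

Lemma opp3_char2 (x : F * F * F) : - x = x.
Proof. by apply/eqP; rewrite eq_sym -addr_eq0 (add3_char2 char2). Qed.

Lemma sum3_char2 (x y z : F * F * F) : (x + y) + (y + z) + (x + z) = 0.
Proof.
have e (a b d : F) : (a + b) + (b + d) + (a + d) = 0.
  by transitivity ((a + a) + (b + b) + (d + d)); [ring|rewrite !char2].
by case: x y z => [[x1 x2] x3] [[y1 y2] y3] [[z1 z2] z3]; congr (_, _, _); apply: e.
Qed.

Lemma line_edge_neq0 x y d : line_edge x y -> x + y = (0, d, 0) -> d != 0.
Proof.
move=> xy e; apply/eqP => d0; have exy : x = y.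
  by apply/eqP; rewrite -subr_eq0 opp3_char2 e d0.
by move: xy; rewrite exy line_edge_irr.
Qed.

(** Two elements of [S] would sum to a nonzero multiple of the nucleus. *)
Lemma cross2_line x1 y1 x2 y2 x3 y3 : (x1 + y1) + (x2 + y2) + (x3 + y3) = 0 ->
  x1 + y1 \in S -> x2 + y2 \in S -> ~~ line_edge x3 y3.
Proof.
move=> e s1 s2; apply/negP => /[dup] /line_edgeP[d e3 _] l3.
have /eqP := line_edge_neq0 l3 e3; apply; apply: (conic_set_nucleus char2 l0D s1 s2).
by apply/eqP; rewrite -e3 -subr_eq0 opp3_char2 e.
Qed.

Lemma line2_cross x1 y1 x2 y2 x3 y3 : (x1 + y1) + (x2 + y2) + (x3 + y3) = 0 ->
  line_edge x1 y1 -> line_edge x2 y2 -> x3 + y3 \notin S.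
Proof.
move=> e /line_edgeP[d1 e1 _] /line_edgeP[d2 e2 _]; apply/negP => /(conic_set_neq0 l0D).
have := congr1 (fun v => v.1.1) e; rewrite e1 e2 /= !add0r => ->.
by rewrite eqxx.
Qed.

(* [line_pool] lies in [l0 = 1, l1 = 0] and [h] in [l0 = 0, l1 = 1], so no three
   elements of [h |: line_pool] sum to zero. *)
Lemma line3 x1 y1 x2 y2 x3 y3 : (x1 + y1) + (x2 + y2) + (x3 + y3) = 0 ->
  line_edge x1 y1 -> line_edge x2 y2 -> ~~ line_edge x3 y3.
Proof.
have gen d a : (d \in P) || (d == h) && a -> l1 d = ~~ l0 d.
  case/orP => [|/andP[/eqP-> _]]; rewrite ?l0h ?l1h // inE.
  by case/andP=> -> /negbTE->.
move=> e /line_edgeP[d1 e1 /gen g1] /line_edgeP[d2 e2 /gen g2].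
apply/negP => /line_edgeP[d3 e3 /gen g3].
have := congr1 (fun v => v.1.2) e; rewrite e1 e2 e3 /= => d0.
have := congr1 l0 d0; have := congr1 l1 d0.
rewrite !l0D !l1D g1 g2 g3 (l00 l0D).
have := l1D 0 0; rewrite addr0 => l10; have {l10} -> : l1 0 = false by case: (l1 0) l10.
by case: (l0 d1); case: (l0 d2); case: (l0 d3).
Qed.

Lemma edge_triangle_free u v w : ~~ [&& edge u v, edge v w & edge u w].
Proof.
case: u v w => [x|i] [y|j] [z|k]; rewrite /= ?andbF //.
- apply/negP => /and3P[xy yz xz].
  have e := sum3_char2 x y z.
  have e' : (x + y) + (x + z) + (y + z) = 0 by rewrite addrAC.
  have e'' : (y + z) + (x + z) + (x + y) = 0 by rewrite [LHS]addrC [LHS]addrA.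
  (* Each side of the triangle is a Cayley edge or a line edge, which gives eight cases. *)
  case/orP: xy xz yz => [s1|t1] /orP[s3|t3] /orP[s2|t2].
  + by have := conic_set_sum3 l0D s1 s2 s3; rewrite e eqxx.
  + by have := cross2_line e' s1 s3; rewrite t2.
  + by have := cross2_line e s1 s2; rewrite t3.
  + by have := line2_cross e'' t2 t3; rewrite s1.
  + by have := cross2_line e'' s2 s3; rewrite t1.
  + by have := line2_cross e t1 t2; rewrite s3.
  + by have := line2_cross e' t1 t3; rewrite s2.
  + by have := line3 e t1 t2; rewrite t3.
- by apply/negP => /and3P[xy yk xk]; move: (edge_attached xk yk) => /=; rewrite xy.
- by apply/negP => /and3P[xj zj xz]; move: (edge_attached xj zj) => /=; rewrite xz.
- by apply/negP => /and3P[yi yz zi]; move: (edge_attached yi zi) => /=; rewrite yz.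
Qed.

(** For an old vertex: [cross_degree] Cayley edges, cK + 1 - [cross_degree] pool edges, and exactly
    one edge along [h] or to an inserted vertex. *)
Lemma edge_degree :
  {in vertices, forall u, #|[set v in vertices | edge u v]| = (c * K + 2)%N}.
Proof.
move=> u; rewrite -sum1_card big_sumType /=.
have e0 (A : finType) (p q : pred A) : p =1 q -> (\sum_(x | p x) 1 = \sum_x q x)%N.
  by move=> pq; rewrite big_mkcond; apply: eq_bigr => x _; rewrite pq; case: (q x).
case: u => [x|j] xW; last first.
  rewrite (e0 _ _ (fun y => y \in I j)); last first.
    by move=> y; rewrite !inE; apply: andb_idl => /I_part ->.
  rewrite [X in (_ + X)%N]big_pred0 ?addn0; last by move=> k; rewrite !inE.
  by rewrite -(I_card j) -sum1_card [RHS]big_mkcond; apply: eq_bigr => y _; case: (y \in I j).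
have xo : x \in old by move: xW; rewrite inE.
have gb := cross_degree_bounds xo; have cg := card_line_gens xo.
rewrite (e0 _ _ (fun j => x \in I j)); last by move=> j; rewrite !inE.
rewrite (e0 _ _ (fun y => (y \in old) && ((x + y \in S) || line_edge x y))); last first.
  by move=> y; rewrite !inE.
have -> : (\sum_j (x \in I j) = (x \in attached))%N.
  have [/attachedP[j xj]|xA] := boolP (x \in attached).
    rewrite (bigD1 j) //= xj big1 // => i ij; apply/eqP; rewrite eqb0.
    by apply: contra ij => xi; apply/eqP; exact: I_disj xi xj.
  by rewrite big1 // => j _; apply/eqP; rewrite eqb0; apply: contra xA => xj; apply/attachedP; exists j.
pose L y := [&& x.1.1 == y.1.1, x.2 == y.2 & x.1.2 + y.1.2 \in line_gens x.1.1 x.2].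
pose H (y : F * F * F) := (y == x + (0, h, 0)) && (x \notin attached).
have lineLH y : line_edge x y = L y || H y.
  rewrite /line_edge /L /H; case: (x) y => [[a b] z] [[a' b'] z'] /=.
  have -> : ((a', b', z') == (a, b, z) + (0, h, 0)) = [&& a == a', z == z' & b + b' == h].
    rewrite -[LHS]/((a' == a + 0) && (b' == b + h) && (z' == z + 0)) !addr0.
    rewrite [a' == a]eq_sym [z' == z]eq_sym [LHS]andbAC -andbA; congr [&& _, _ & _].
    by rewrite -subr_eq0 opprD !(opp_char2 char2) addrA -[in RHS](opp_char2 char2 h)
      -addr_eq0 (addrC b).
  by case: (a == a') => //=; case: (z == z').
have exLH y : L y -> ~~ H y.
  case/and3P=> _ _ /line_gens_pool/pool_shift; rewrite /H => ne.
  apply/negP => /andP[/eqP e _]; move: ne.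
  by rewrite e /= addrA char2 add0r eqxx.
have line_old y : line_edge x y -> y \in old.
  by case/and3P=> /eqP e1 /eqP e2 _; move: xo; rewrite !inE -e1 -e2.
(* The three kinds of old neighbours exclude each other, so their indicators add. *)
have LH y : (y \in old) && ((x + y \in S) || line_edge x y) =
    (((y \in old) && ((x + y)%R \in S)) + L y + H y)%N :> nat.
  have [ly|] := boolP (line_edge x y).
    rewrite (line_old y ly) (negbTE (cross_line ly)) /=; move: ly; rewrite lineLH.
    by case Ly: (L y) => /=; [rewrite (negbTE (exLH y Ly))|move=> ->].
  by rewrite lineLH negb_or orbF => /andP[/negbTE-> /negbTE->]; rewrite !addn0.
rewrite (eq_bigr _ (fun y _ => LH y)) !big_split /=.
have -> : (\sum_y ((y \in old) && ((x + y)%R \in S)) = cross_degree x.1.1 x.2)%N.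
  rewrite -cross_degreeE -sum1_card [RHS]big_mkcond; apply: eq_bigr => y _; rewrite in_set.
  by case: (_ && _).
have -> : (\sum_y L y = #|line_gens x.1.1 x.2|)%N.
  pose f d : F * F * F := (x.1.1, x.1.2 + d, x.2).
  have finj : injective f by move=> d d' [] /addrI.
  rewrite -(card_imset _ finj) -sum1_card [RHS]big_mkcond; apply: eq_bigr => y _.
  suff -> : (y \in f @: line_gens x.1.1 x.2) = L y by case: (L y).
  apply/imsetP/and3P => [[d dG ->]|[/eqP e1 /eqP e2 dG]].
    by rewrite /= addrA char2 add0r !eqxx.
  exists (x.1.2 + y.1.2) => //; rewrite /f addrA char2 add0r e1 e2.
  by case: (y) => [[]].
have -> : (\sum_y H y = (x \notin attached))%N.
  by rewrite (bigD1 (x + (0, h, 0))) //= /H eqxx big1 ?addn0 // => y /negbTE ->.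
by rewrite cg; move: gb; case: (x \in attached) => /=; lia.
Qed.

(** * Bounding the quadratic form *)

Section QuadraticForm.
Variable R : realFieldType.
Let q : R := #|F|%:R.

Lemma line_edge_count x : \sum_y (line_edge x y)%:R <= q.
Proof.
rewrite -natr_sum ler_nat.
pose f d : F * F * F := (x.1.1, d, x.2).
have finj : injective f by move=> d d' [].
rewrite -[leqRHS]cardsT -(card_imset _ finj) -sum1_card [leqRHS]big_mkcond.
apply: leq_sum => y _; case xy: (line_edge x y) => //.
suff -> : y \in f @: setT by [].
by case/and3P: xy => /eqP e1 /eqP e2 _; apply/imsetP; exists y.1.2; rewrite // /f e1 e2;
  case: (y) => [[]].
Qed.

Lemma sum_vertices (G : F * F * F + 'I_r -> R) :
  \sum_(u in vertices) G u
    = \sum_x (if x \in old then G (inl x) else 0) + \sum_j G (inr j).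
Proof.
rewrite big_sumType /=; congr (_ + _).
  by rewrite -big_mkcond; apply: eq_bigl => x; rewrite inE.
by apply: eq_bigl => j; rewrite inE.
Qed.

(** The Cayley part costs 3q, line edges q, attaching edges q and the rank-one correction q on old
    vertices. Inserted vertices cost q from attaching and q + 1 from the correction. Both totals are
    at most 7q. *)
Lemma edge_quad_bound (f : F * F * F + 'I_r -> R) :
  (r <= #|F|)%N -> (c * K + 2 <= #|F| ^ 2)%N ->
  `|\sum_(u in vertices) \sum_(v in vertices) (edge u v)%:R * f u * f v
    - #|S|%:R / q ^+ 3 * (\sum_(u in vertices) f u) ^+ 2|
  <= 7 * q * \sum_(u in vertices) f u ^+ 2.
Proof.
move=> r_le d_le.
(* Extension by zero carries the Fourier bound on the whole of F^3 over to the subgraph induced on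
   [old]. *)
pose o x := if x \in old then f (inl x) else 0; pose n j := f (inr j).
pose Q1 := \sum_(x : F * F * F) \sum_(y : F * F * F) (x + y \in S)%:R * o x * o y.
pose Q2 := \sum_x \sum_y (line_edge x y)%:R * o x * o y.
pose Q3 := \sum_x \sum_j (x \in I j)%:R * o x * n j.
have -> : \sum_(u in vertices) \sum_(v in vertices) (edge u v)%:R * f u * f v
    = Q1 + Q2 + 2 * Q3.
  rewrite sum_vertices.
  have -> : \sum_j \sum_(v in vertices) (edge (inr j) v)%:R * f (inr j) * f v = Q3.
    rewrite /Q3 [RHS]exchange_big; apply: eq_bigr => j _ /=; rewrite sum_vertices /=.
    rewrite [X in _ + X]big1 ?addr0 => [|k _]; last by rewrite !mul0r.
    by apply: eq_bigr => x _; rewrite /o; case: ifP => _; rewrite ?mulr0 ?mul0r // mulrAC.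
  rewrite mulr_natl mulr2n addrA; congr (_ + _).
  rewrite /Q1 /Q2 /Q3 -!big_split /=; apply: eq_bigr => x _.
  rewrite /o; case: ifP => xo; last first.
    by rewrite !big1 ?addr0 // => ? _; rewrite mulr0 mul0r.
  rewrite sum_vertices -!big_split /=; congr (_ + _); apply: eq_bigr => y _ /=.
  case: ifP => yo; last by rewrite !mulr0 addr0.
  have [/cross_line/negbTE->|] := boolP (line_edge x y); first by rewrite mul0r mul0r add0r.
  by rewrite orbF !mul0r addr0.
rewrite !sum_vertices; set So := \sum_x _; set Sn := \sum_j _.
have -> : \sum_x (if x \in old then f (inl x) ^+ 2 else 0) = \sum_x o x ^+ 2.
  by apply: eq_bigr => x _; rewrite /o; case: ifP => // _; rewrite expr0n.
set A := \sum_x o x ^+ 2; set B := \sum_j f (inr j) ^+ 2; set k := _ / _.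
have F0 : (0 < #|F|)%N by apply/card_gt0P; exists 0.
have q1 : 1 <= q by rewrite ler1n.
have q0 : 0 < q by exact: lt_le_trans ltr01 q1.
have A0 : 0 <= A by apply: sumr_ge0 => x _; exact: sqr_ge0.
have B0 : 0 <= B by apply: sumr_ge0 => x _; exact: sqr_ge0.
have b1 : `|Q1 - k * So ^+ 2| <= 3 * q * A.
  have lu : exists u, l0 u by have [u [lu _ _]] := lsurj true false false; exists u.
  have := fourier_quad_bound o char2 l0D lu
    (@fourier_conic_set _ _ _ _ l0D l1D l2D lsurj R).
  have -> : \sum_z (z \in S)%:R = #|S|%:R :> R.
    by rewrite -natr_sum -sum1_card [in RHS]big_mkcond; congr (_%:R);
      apply: eq_bigr => z _; case: (z \in S).
  suff -> : \sum_(x : F * F * F) \sum_(z : F * F * F) (z \in S)%:R * o x * o (x + z) = Q1 by [].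
  apply: eq_bigr => x _; rewrite [RHS](reindex_inj (addrI x)) /=.
  by apply: eq_bigr => z _; rewrite addrA (add3_char2 char2) add0r.
have b2 : `|Q2| <= q * A.
  have cnt y : \sum_x (line_edge x y)%:R <= q.
    by under eq_bigr do rewrite line_edge_sym; exact: line_edge_count.
  by have := bilinear_amgm o o ltr01 line_edge_count cnt; rewrite mul1r divr1 -/A -/Q2; lra.
(* The weight [q] balances row sums at most 1 against column sums at most q^2. *)
have b3 : 2 * `|Q3| <= q * A + q * B.
  have row x : \sum_j (x \in I j)%:R <= 1 :> R.
    have [/attachedP[j xj]|xA] := boolP (x \in attached).
      rewrite (bigD1 j) //= xj big1 ?addr0 // => i ij.
      by case xi: (x \in I i) => //; rewrite (I_disj xi xj) eqxx in ij.
    by rewrite big1 // => j _; case xj: (x \in I j) => //; case/attachedP: xA; exists j.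
  have col j : \sum_x (x \in I j)%:R <= q ^+ 2 :> R.
    rewrite -natr_sum -natrX ler_nat (leq_trans _ d_le) // -(I_card j) -sum1_card.
    by rewrite [leqRHS]big_mkcond; apply: leq_sum => x _; case: (x \in I j).
  have := bilinear_amgm (e := fun x j => x \in I j) o n q0 row col.
  by rewrite mulr1 expr2 mulfK ?lt0r_neq0.
have b4 : `|k * (2 * So * Sn + Sn ^+ 2)| <= q * A + (q + 1) * B.
  have k0 : 0 <= k by rewrite divr_ge0 ?exprn_ge0 // ltW.
  have kq : k * q <= 1.
    have cS : #|S|%:R <= q ^+ 2 :> R.
      rewrite -natrX ler_nat (card_conic_set l1 l2 l0D) expnS expn1 leq_mul ?leq_pred //.
      exact: max_card.
    have -> : k * q = #|S|%:R / q ^+ 2 by rewrite /k; field; exact: lt0r_neq0.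
    by rewrite ler_pdivrMr ?exprn_gt0 // mul1r.
  have s1 : So ^+ 2 <= q ^+ 3 * A.
    have := sqr_sum_le o; rewrite !card_prod !natrM -/q -/A -/So.
    by have -> : q ^+ 3 = q * q * q by ring.
  have s2 : Sn ^+ 2 <= q * B.
    apply: le_trans (sqr_sum_le _) _; rewrite card_ord ler_wpM2r // ler_nat //.
  exact: rank1_correction.
have -> : Q1 + Q2 + 2 * Q3 - k * (So + Sn) ^+ 2
    = (Q1 - k * So ^+ 2) + Q2 + 2 * Q3 - k * (2 * So * Sn + Sn ^+ 2) by ring.
have qA : 0 <= q * A by rewrite mulr_ge0 // ltW.
have qB : 0 <= (q - 1) * B by rewrite mulr_ge0 // subr_ge0.
have b3' : `|2 * Q3| <= q * A + q * B by rewrite normrM (@ger0_norm _ 2).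
move: b1 b2 b3' b4; rewrite !ler_norml.
do 4 (case/andP=> ? ?); apply/andP; split; lra.
Qed.
End QuadraticForm.

End Construction.

(* The j-th set lives in the plane of rank j mod c, in the j / c-th block of c/2
   lines. *)
Lemma attaching_sets (F : finFieldType) (l0 : F -> bool) (h : F) (c r m : nat) :
  (forall x : F, x + x = 0) -> (forall x y, l0 (x + y) = l0 x (+) l0 y) ->
  l0 h = false -> h != 0 -> (0 < c < #|F|)%N -> (r <= #|F|)%N ->
  (m * 2 <= #|line_kernel l0| * c./2)%N ->
  exists I : 'I_r -> {set F * F * F},
    [/\ forall j x, x \in I j -> (enum_rank x.1.1 < c)%N,
        forall j x, x \in I j -> ~~ l0 x.1.2,
        forall j x y, x \in I j -> y \in I j -> x.1.1 = y.1.1,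
        forall j x, x \in I j -> x + (0, h, 0) \in I j
      & (forall j, #|I j| = (m * 2)%N) /\
        (forall i j x, x \in I i -> x \in I j -> i = j)].
Proof.
move=> char2 l0D l0h h0 /andP[c0 cF] rF mX; pose w := c./2.
pose X (j : 'I_r) : {set F * F * F} :=
  [set x | [&& enum_rank x.1.1 == (j %% c)%N :> nat, ~~ l0 x.1.2
    & (j %/ c * w <= enum_rank x.2 < j %/ c * w + w)%N]].
(* The blocks of lines fit into [F]: (j / c) w is at most j / 2 and [w] at most c / 2, both below q
   / 2. *)
have w2 : (w * 2 <= c)%N by rewrite /w; lia.
have cX j : #|X j| = (#|line_kernel l0| * w)%N.
  have -> : X j = setX (setX [set a : F | (j %% c <= enum_rank a < j %% c + 1)%N]
      (line_kernel l0)) [set z : F | (j %/ c * w <= enum_rank z < j %/ c * w + w)%N].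
    apply/setP=> [[[a b] z]]; rewrite !inE /= addn1 ltnS.
    by rewrite [_ == (j %% c)%N :> nat]eqn_leq [(_ <= j %% c)%N && _]andbC -!andbA.
  rewrite !cardsX !card_rank_interval ?mul1n //.
    have jF : (j < #|F|)%N by rewrite (leq_trans _ rF).
    by have := divn_eq j c; move: (j %/ c)%N (j %% c)%N => s t e; nia.
  by rewrite addn1 (ltn_trans _ cF) // ltn_mod.
have shift j x : x \in X j -> x + (0, h, 0) \in X j.
  by rewrite !inE /= !addr0 l0D l0h addbF.
have inv : involutive (fun x : F * F * F => x + (0, h, 0)).
  by move=> x; rewrite -addrA (add3_char2 char2) addr0.
have nofix (x : F * F * F) : x + (0, h, 0) != x.
  rewrite -subr_eq0 addrAC subrr add0r.
  by apply: contraNneq h0 => /(congr1 (fun v => v.1.2)) /= ->.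
have ex j : exists Y : {set F * F * F}, [/\ Y \subset X j,
    {in Y, forall x, x + (0, h, 0) \in Y} & #|Y| = (m * 2)%N].
  by apply: invariant_subset => //; [exact: shift|rewrite cX].
have [I HI] := fin_all_exists ex.
have IX j x : x \in I j -> x \in X j by have [/subsetP sub _ _] := HI j; exact: sub.
exists I; split.
- by move=> j x /IX; rewrite inE => /and3P[/eqP-> _ _]; rewrite ltn_mod.
- by move=> j x /IX; rewrite inE => /and3P[].
- move=> j x y /IX + /IX; rewrite !inE => /and3P[/eqP e1 _ _] /and3P[/eqP e2 _ _].
  by apply/enum_rank_inj/val_inj; rewrite /= e1 e2.
- by move=> j x; have [_ sh _] := HI j; exact: sh.
split=> [j|i j x /IX + /IX]; first by have [] := HI j.
(* The plane determines [j] mod [c] and the block of lines determines j / c. *)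
rewrite !inE => /and3P[/eqP e1 _ /andP[a1 b1]] /and3P[/eqP e2 _ /andP[a2 b2]].
apply: val_inj; rewrite /= (divn_eq i c) (divn_eq j c) -e1 -e2.
congr (_ * _ + _)%N; move: (i %/ c)%N (j %/ c)%N a1 b1 a2 b2 => s t; nia.
Qed.

(** Two Euclidean divisions give n = c q^2 + c' q + r with all three digits below [q]; this fixes
    the parameters of the construction. *)
Lemma triangle_free_expander (R : realType) (k n : nat) :
  (4 <= k)%N -> (4 <= n %/ (2 ^ k) ^ 2 < 2 ^ k)%N ->
  exists G : sgraph n,
    [/\ regular G (n %/ (2 ^ k) ^ 2 * 2 ^ (k - 3) + 2), triangle_free G
      & graph_lambda R G <= 7 * (2 ^ k)%:R].
Proof.
move=> k4; set q := (2 ^ k)%N; set c := (n %/ q ^ 2)%N => /andP[c4 cq].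
have [|F [l0 [l1 [l2 [cF char2 [l0D l1D l2D] lsurj]]]]] := @char2_field_functionals k.
  exact: ltnW.
have [h [l0h l1h _]] := lsurj false true false.
have h0 : h != 0.
  apply: contraTneq l1h => ->; have := l1D 0 0; rewrite addr0.
  by case: (l1 0).
pose K := #|coset8 l0 l1 l2 true|.
have qE : q = (2 ^ (k - 4) * 16)%N by rewrite -[16%N]/(2 ^ 4)%N -expnD subnK.
have k3E : (2 ^ (k - 3) = 2 ^ (k - 4) * 2)%N by rewrite -expnSr; congr (2 ^ _)%N; lia.
have K8 : (K * 8 = #|F|)%N := card_coset8 l0D l1D l2D lsurj true.
have KE : K = (2 ^ (k - 3))%N by move: K8; rewrite cF -/q qE k3E; lia.
have Z2 : (#|line_kernel l0| * 2 = #|F|)%N := card_line_kernel char2 l0D lsurj.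
have p0 : (0 < 2 ^ (k - 4))%N by rewrite expn_gt0.
have K2 : (2 <= K)%N by rewrite KE k3E; lia.
(* Half the degree. The degree must be even because attaching sets are unions of [h]-orbits; k >= 4
   makes [K] even. *)
pose m := (c * 2 ^ (k - 4) + 1)%N.
have dE : (m * 2 = c * K + 2)%N by rewrite /m KE k3E; lia.
pose c' := (n %% q ^ 2 %/ q)%N; pose r := (n %% q ^ 2 %% q)%N.
have q0 : (0 < q)%N by rewrite expn_gt0.
have rq : (r < q)%N by rewrite ltn_mod.
have c'q : (c' < q)%N by rewrite ltn_divLR // mulnn ltn_mod expn_gt0 q0.
have nE : n = (c * q ^ 2 + c' * q + r)%N by rewrite -addnA -divn_eq -divn_eq.
have [|||I [I1 I2 I3 I4 [I5 I6]]] := @attaching_sets F l0 h c r m char2 l0D l0h h0.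
- by rewrite cF cq andbT; exact: leq_trans c4.
- by rewrite cF ltnW.
(* With w = [c./2], 4Kw >= 2K(c - 1) >= cK + 2K, which exceeds cK + 2. *)
- have cw : (c <= c./2 * 2 + 1)%N by lia.
  rewrite dE (_ : #|line_kernel l0| = 4 * K)%N; last by lia.
  have := leq_mul (leqnn K) cw; have := leq_mul c4 (leqnn K).
  by move: (c./2) => w; lia.
have I5' j : #|I j| = (c * K + 2)%N by rewrite I5.
have cF' : (c < #|F|)%N by rewrite cF.
have c'F : (c' < #|F|)%N by rewrite cF.
rewrite -KE.
pose W : {set F * F * F + 'I_r} := vertices F c c' r.
pose E : rel (F * F * F + 'I_r)%type := edge l0 l1 l2 h c c' I.
pose kap : R := #|conic_set l0 l1 l2|%:R / #|F|%:R ^+ 3.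
have cW : #|W| = n by rewrite (card_vertices _ cF' c'F) cF -nE.
have n1 : (1 < n)%N by rewrite (leq_trans _ (leq_div n (q ^ 2))) // (leq_trans _ c4).
have Esym : symmetric E by exact: edge_sym.
have Eirr : {in W, irreflexive E} by move=> u _; exact: edge_irr.
have Edeg : {in W, forall u, #|[set v in W | E u v]| = (c * K + 2)%N}.
  exact: edge_degree.
have Etri : {in W & W & W, forall u v w, ~~ [&& E u v, E v w & E u w]}.
  by move=> u v w _ _ _; apply: edge_triangle_free.
have L0 : 0 <= 7 * #|F|%:R :> R by rewrite mulr_ge0.
have -> : q = #|F| by rewrite cF.
apply: (sgraph_of_rel (k := kap) n1 cW Esym Eirr Edeg Etri L0) => f.
have rF : (r <= #|F|)%N by rewrite cF ltnW.
have dF : (c * K + 2 <= #|F| ^ 2)%N.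
  have := leq_mul (ltnW cF') (leqnn K); have := leq_mul K2 (leqnn K).
  by rewrite -/K -K8; lia.
exact: (edge_quad_bound char2 l0D l1D l2D lsurj c' I4 I5' I6 f rF dF).
Qed.

(** * Choice of q and numerical estimates *)

Lemma powR_two_thirds_le (R : realType) (n x : nat) :
  (n ^ 2 <= x ^ 3)%N -> n%:R `^ (2 / 3) <= x%:R :> R.
Proof.
move=> nx.
have -> : x%:R = (x%:R ^+ 3) `^ 3^-1 :> R.
  by rewrite -powR_mulrn // -powRrM divff ?powRr1 ?pnatr_eq0.
have -> : n%:R `^ (2 / 3) = (n%:R ^+ 2) `^ 3^-1 :> R.
  by rewrite -powR_mulrn // -powRrM.
by apply: ge0_ler_powR; rewrite ?nnegrE ?invr_ge0 ?exprn_ge0 // -!natrX ler_nat.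
Qed.

Lemma ln_nat_ge1 (R : realType) (n : nat) : (4 <= n)%N -> 1 <= ln n%:R :> R.
Proof.
move=> n4; have n0 : 0 < n%:R :> R by rewrite ltr0n; exact: leq_trans n4.
(* From exp(-1/2) >= 1 - 1/2; squaring then gives e <= 4. *)
have e2 : expR (2^-1) <= 2 :> R.
  rewrite -[2^-1]opprK expRN -[leRHS]invrK lef_pV2 ?posrE ?invr_gt0 ?expR_gt0 //.
  by have := expR_ge1Dx (- 2^-1 : R); lra.
have e1 : expR (1 : R) = expR 2^-1 * expR 2^-1.
  by rewrite -expRD; congr expR; lra.
have e4 : expR (1 : R) <= n%:R.
  have e0 := expR_ge0 (2^-1 : R); have : 4 <= n%:R :> R by rewrite ler_nat.
  have := ler_pM e0 e0 e2 e2; rewrite -e1; lra.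
by move: e4; rewrite -ler_ln ?posrE ?expR_gt0 // expRK.
Qed.

Theorem theorem1p6 (R : realType) :
  exists N : nat, forall n : nat, (N <= n)%N ->
    exists (G : sgraph n) (d : nat),
      [/\ regular G d,
          triangle_free G,
          1 / 20 * n%:R `^ (2 / 3) <= d%:R :> R
        & graph_lambda R G <= 200 * Num.sqrt (d%:R * ln n%:R)].
Proof.
exists (8 ^ 5)%N => n n_ge.
(* This choice gives q^3 / 8 <= n < q^3, hence q / 8 <= c < q. The threshold 8^5 ensures q >= 32 and
   so c >= 4. *)
pose k := (trunc_log 8 n).+1; pose q := (2 ^ k)%N; pose c := (n %/ q ^ 2)%N.
have n4 : (4 <= n)%N by exact: leq_trans n_ge.
have n0 : (0 < n)%N by exact: leq_trans n4.
have k5 : (5 < k)%N by rewrite ltnS trunc_log_max.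
have q3 : (q ^ 3 = 8 ^ k)%N by rewrite -expnM mulnC expnM.
have n_lt : (n < q ^ 3)%N by rewrite q3 trunc_log_ltn.
have n_gt : (q ^ 3 <= 8 * n)%N by rewrite q3 expnS leq_mul // trunc_logP.
have q0 : (0 < q)%N by rewrite expn_gt0.
have q32 : (32 <= q)%N by rewrite -[32%N]/(2 ^ 5)%N leq_exp2l // ltnW.
have qE : (q = 8 * 2 ^ (k - 3))%N by rewrite -[8%N]/(2 ^ 3)%N -expnD subnKC // (leq_trans _ k5).
have cq : (c < q)%N by rewrite ltn_divLR ?expn_gt0 ?q0 // -expnS.
have qc : (2 ^ (k - 3) <= c)%N.
  rewrite leq_divRL ?expn_gt0 ?q0 //; move: n_gt; rewrite expnS {1}qE -mulnA.
  by rewrite leq_pmul2l.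
have c4 : (4 <= c)%N by lia.
have [|/=|G [Greg Gtri Glam]] := @triangle_free_expander R k n.
- by rewrite (leq_trans _ k5).
- by rewrite c4 cq.
exists G, (c * 2 ^ (k - 3) + 2)%N; split => //.
  (* Since n <= (c + 1) q^2 and q <= 8 (c + 1), n^2 is at most the cube of 2 (c + 1) q; this in turn
     is at most 20 d because c >= 4. *)
  have : n%:R `^ (2 / 3) <= (2 * (c + 1) * q)%N%:R :> R.
    apply: powR_two_thirds_le.
    have n_le : (n <= (c + 1) * q ^ 2)%N.
      by rewrite addn1 ltnW // -ltn_divLR ?expn_gt0 ?q0.
    have : (n ^ 2 <= ((c + 1) * q ^ 2) ^ 2)%N by rewrite leq_exp2r.
    move/leq_trans; apply.
    have -> : (((c + 1) * q ^ 2) ^ 2 = (c + 1) ^ 2 * q ^ 3 * q)%N by lia.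
    have -> : ((2 * (c + 1) * q) ^ 3 = (c + 1) ^ 2 * q ^ 3 * (8 * (c + 1)))%N by lia.
    by rewrite leq_mul2l; apply/orP; right; lia.
  have : (2 * (c + 1) * q <= 20 * (c * 2 ^ (k - 3) + 2))%N by rewrite qE; nia.
  rewrite -(ler_nat R) natrM => h1 h2; have := le_trans h2 h1; lra.
apply: le_trans Glam _.
have ln1 := ln_nat_ge1 R n4.
(* From c >= q / 8, d >= q^2 / 64. With log n >= 1 the root is at least q / 8, and 7q <= 200 q /
   8. *)
have d_ge : (q ^ 2 <= 64 * (c * 2 ^ (k - 3) + 2))%N by rewrite qE; nia.
have s_ge : q%:R / 8 <= Num.sqrt ((c * 2 ^ (k - 3) + 2)%:R * ln n%:R) :> R.
  rewrite -[leLHS]ger0_norm ?divr_ge0 // -sqrtr_sqr ler_wsqrtr //.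
  apply: (@le_trans _ _ (c * 2 ^ (k - 3) + 2)%:R); last by rewrite ler_peMr.
  move: d_ge; move: (c * 2 ^ (k - 3) + 2)%N => d; rewrite -(ler_nat R) natrX natrM.
  by rewrite expr_div_n ler_pdivrMr //; lra.
have qR : 0 <= q%:R :> R by [].
by rewrite -/q; lra.
Qed.
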